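(* Let $\mathbb{F}$ be a field of constant characteristic $p$ (possibly $0$) and let $n\in\mathbb{N}$ be a growing parameter. Let $f\in s\mathcal{B}_n$ be arbitrary and let $(g,h)$ be a standard decomposition of $f$. Then for any $\varepsilon\in[1/2^n,1/3]$: 1. $\mathrm{pdeg}^{\mathbb{F}}_\varepsilon(g)=\widetilde{\Omega}(\sqrt{n\log(1/\varepsilon)})$ if $\mathrm{per}(g)>1$ and $\mathrm{per}(g)$ is not a power of $p$, and $\mathrm{pdeg}^{\mathbb{F}}_\varepsilon(g)=\widetilde{\Omega}(\min\{\sqrt{n\log(1/\varepsilon)},\mathrm{per}(g)\})$ otherwise. 2. $\mathrm{pdeg}^{\mathbb{F}}_\varepsilon(h)=\widetilde{\Omega}(\sqrt{B(h)\log(1/\varepsilon)}+\log(1/\varepsilon))$ if $B(h)\ge 1$. 3. $\mathrm{pdeg}^{\mathbb{F}}_\varepsilon(f)$ is - $\widetilde{\Omega}(\sqrt{n\log(1/\varepsilon)})$ if $\mathrm{per}(g)>1$ and not a power of $p$; - $\widetilde{\Omega}(\min\{\sqrt{n\log(1/\varepsilon)},\mathrm{per}(g)\})$ if $\mathrm{per}(g)$ is a power of $p$ and $B(h)=0$; - $\widetilde{\Omega}\big(\min\{\sqrt{n\log(1/\varepsilon)},\ \mathrm{per}(g)+\sqrt{B(h)\log(1/\varepsilon)}+\log(1/\varepsilon)\}\big)$ otherwise. Here $\widetilde{\Omega}(\cdot)$ hides $\mathrm{poly}(\log n)$ factors (independent of $\varepsilon$).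
   Context: A probabilistic polynomial over $\mathbb{F}$ with error $\varepsilon$ for $f:\{0,1\}^n\to\{0,1\}$ is a random polynomial $\mathbf{P}\in\mathbb{F}[x_1,\dots,x_n]$ (finitely supported distribution) with $\Pr[\mathbf{P}(a)\ne f(a)]\le\varepsilon$ for every $a\in\{0,1\}^n$; its degree is at most $d$ if every polynomial in the support has degree at most $d$. $\mathrm{pdeg}^{\mathbb{F}}_\varepsilon(f)$ is the least such $d$. $s\mathcal{B}_n$ is the set of symmetric Boolean functions on $n$ variables; each $f\in s\mathcal{B}_n$ has a spectrum $\mathrm{Spec}\,f:[0,n]\to\{0,1\}$ with $f(a)=\mathrm{Spec}\,f(|a|)$. $\mathrm{per}(f)$ is the smallest positive integer $b$ with $\mathrm{Spec}\,f(i)=\mathrm{Spec}\,f(i+b)$ for all $i\in[0,n-b]$. $f$ is $k$-bounded if $\mathrm{Spec}\,f$ is constant on $[k,n-k]$; $B(f)$ is the smallest such $k$. Standard decomposition: among all $f'\in s\mathcal{B}_n$ with $\mathrm{Spec}\,f'(i)=\mathrm{Spec}\,f(i)$ for all $i\in[\lceil n/3\rceil,\lfloor 2n/3\rfloor]$, choose $g$ with $\mathrm{per}(g)$ as small as possible, and let $h=f\oplus g$; $(g,h)$ is a standard decomposition. ''A power of $p$'' means $p^k$ for an integer $k\ge0$.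
   Formalization: The ''otherwise'' bound in item 1 and the second bullet of item 3 additionally assume per(g) > 1; when per(g) = 1 the function concerned is constant, with probabilistic degree 0, so the stated bound fails. *)

(* Defs.v *)
From HB Require Import structures.
From mathcomp Require Import all_boot all_order all_algebra finmap.
From mathcomp Require Import mpoly.
From mathcomp Require Import boolp classical_sets reals exp.
Set Implicit Arguments.
Unset Strict Implicit.
Unset Printing Implicit Defensive.

Import Order.TTheory GRing.Theory Num.Theory.
Local Open Scope ring_scope.

Notation cube n := {ffun 'I_n -> bool}.
Notation boolfun n := {ffun cube n -> bool}.

Definition weight (n : nat) (a : cube n) : nat := #|[set i | a i]|.

(* Membership in $s\mathcal{B}_n$. *)
Definition symfun (n : nat) (f : boolfun n) : Prop :=
  forall a b : cube n, weight a = weight b -> f a = f b.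

(* $\mathrm{Spec} f(i)$ is read off at the point $1^i0^{n-i}$; only the values
   at [i <= n] are meaningful, and every use below is guarded accordingly. *)
Definition Spec (n : nat) (f : boolfun n) (i : nat) : bool :=
  f [ffun j : 'I_n => (j < i)%N].

Lemma SpecE (n : nat) (f : boolfun n) (a : cube n) :
  symfun f -> f a = Spec f (weight a).
Proof.
move=> sf; apply: sf; rewrite /weight.
have wn : (#|[set i | a i]| <= n)%N by rewrite -[leqRHS]card_ord max_card.
have inj_w : injective (widen_ord wn).
  by move=> x y /(congr1 val) /= /val_inj.
rewrite -[LHS]card_ord -(card_imset _ inj_w).
apply: eq_card => i; rewrite inE ffunE; apply/imsetP/idP => [[j _ ->]|lti] /=.
  exact: ltn_ord.
by exists (Ordinal lti) => //; apply: val_inj.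
Qed.

(* [i + b <= n] encodes $i\in[0,n-b]$, an empty range when $b>n$. *)
Definition is_period (n : nat) (f : boolfun n) (b : nat) : bool :=
  (0 < b)%N &&
  [forall i : 'I_n.+1, (i + b <= n)%N ==> (Spec f i == Spec f (i + b))].

Lemma is_period_ex (n : nat) (f : boolfun n) : exists b, is_period f b.
Proof.
exists n.+1; rewrite /is_period /=; apply/forallP => i.
by rewrite addnS ltnNge leq_addl.
Qed.

Definition per (n : nat) (f : boolfun n) : nat := ex_minn (is_period_ex f).

(* [k <= i] and [i + k <= n] encode $i\in[k,n-k]$. *)
Definition is_bounded (n : nat) (f : boolfun n) (k : nat) : bool :=
  [forall i : 'I_n.+1, forall j : 'I_n.+1,
     [&& (k <= i)%N, (i + k <= n)%N, (k <= j)%N & (j + k <= n)%N] ==>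
     (Spec f i == Spec f j)].

Lemma is_bounded_ex (n : nat) (f : boolfun n) : exists k, is_bounded f k.
Proof.
exists n.+1; apply/forallP => i; apply/forallP => j.
by rewrite [(n < i)%N]ltnNge -ltnS ltn_ord.
Qed.

Definition Bnd (n : nat) (f : boolfun n) : nat := ex_minn (is_bounded_ex f).

(* [n <= 3 * i <= 2 * n] encodes
   $i\in[\lceil n/3\rceil,\lfloor 2n/3\rfloor]$. *)
Definition agree_mid (n : nat) (f f' : boolfun n) : Prop :=
  forall i : nat, (n <= 3 * i <= 2 * n)%N -> Spec f' i = Spec f i.

Definition std_decomp (n : nat) (f g h : boolfun n) : Prop :=
  [/\ symfun g, agree_mid f g,
      (forall f' : boolfun n,
         symfun f' -> agree_mid f f' -> (per g <= per f')%N) &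
      h = [ffun a => f a (+) g a]].

(* For $p=0$ the only power is $0^0=1$. *)
Definition power_of (p b : nat) : Prop := exists k : nat, b = (p ^ k)%N.

Definition has_char (F : fieldType) (p : nat) : Prop :=
  p \in [pchar F] \/ (p = 0%N /\ [pchar F] =i pred0).

(* [msize] is the total degree plus one, and 0 for the zero polynomial. *)
Definition deg_le (F : fieldType) (n d : nat) (P : {mpoly F[n]}) : bool :=
  (msize P <= d.+1)%N.

Definition peval (F : fieldType) (n : nat) (P : {mpoly F[n]}) (a : cube n) : F :=
  P.@[fun i => (a i)%:R].

Record rpoly (R : realType) (F : fieldType) (n : nat) := RPoly {
  rweight : {fsfun {mpoly F[n]} -> R with 0};
  rweight_ge0 : forall P, 0 <= rweight P;
  rweight_sum1 : \sum_(P <- finsupp rweight) rweight P = 1 }.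

Definition Pr (R : realType) (F : fieldType) (n : nat)
    (mu : rpoly R F n) (E : pred ({mpoly F[n]})) : R :=
  \sum_(P <- finsupp (rweight mu) | E P) rweight mu P.

Definition prob_poly (R : realType) (F : fieldType) (n : nat)
    (eps : R) (f : boolfun n) (mu : rpoly R F n) : Prop :=
  forall a : cube n, Pr mu (fun P => peval P a != (f a)%:R) <= eps.

Definition pdeg_le (R : realType) (F : fieldType) (n : nat)
    (eps : R) (f : boolfun n) (d : nat) : Prop :=
  exists2 mu : rpoly R F n, prob_poly eps f mu &
    forall P, P \in finsupp (rweight mu) -> deg_le d P.

(* The least [d] such that [pdeg_le F eps f d]; it exists as soon as
   [0 <= eps], see [pdegP]. *)
Definition pdeg (R : realType) (F : fieldType) (n : nat)
    (eps : R) (f : boolfun n) : nat :=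
  xget 0%N [set d | pdeg_le F eps f d /\
               forall e, pdeg_le F eps f e -> (d <= e)%N]%classic.

Definition indic_poly (F : fieldType) (n : nat) (b : cube n) : {mpoly F[n]} :=
  \prod_(i < n) (if b i then 'X_i else 1 - 'X_i).

Definition exact_poly (F : fieldType) (n : nat) (f : boolfun n) :
    {mpoly F[n]} := \sum_(b | f b) indic_poly F b.

Lemma exact_polyE (F : fieldType) (n : nat) (f : boolfun n) (a : cube n) :
  peval (exact_poly F f) a = (f a)%:R.
Proof.
have H : forall b : cube n, peval (indic_poly F b) a = (b == a)%:R.
  move=> b.
  rewrite /peval /indic_poly rmorph_prod /=; case: eqVneq => [->|/eqP neq].
    rewrite big1 // => i _; case: ifP => ai.
      by rewrite mevalXU ai.
    by rewrite mevalB meval1 mevalXU ai subr0.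
  have /existsP[i bi] : [exists i, b i != a i].
    rewrite -negb_forall; apply/negP => /forallP ba; apply: neq.
    by apply/ffunP => i; apply/eqP.
  rewrite (bigD1 i) //=; move: bi; case: (b i); case ai : (a i) => // _.
    by rewrite mevalXU ai mul0r.
  by rewrite mevalB meval1 mevalXU ai subrr mul0r.
rewrite /exact_poly {1}/peval raddf_sum /=.
rewrite (eq_bigr (fun b => (b == a)%:R)) => [|b _]; last exact: H.
case fa : (f a).
  by rewrite (bigD1 a) //= eqxx big1 ?addr0 // => b /andP[_ /negPf->].
by rewrite big1 // => b fb; case: eqVneq fb => // ->; rewrite fa.
Qed.

Lemma pdeg_le_ex (R : realType) (F : fieldType) (n : nat) (eps : R)
    (f : boolfun n) : 0 <= eps -> exists d, pdeg_le F eps f d.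
Proof.
move=> eps0; pose P := exact_poly F f.
pose w : {fsfun {mpoly F[n]} -> R with 0} := [fsfun Q in [fset P]%fset => 1].
have wP : w P = 1 by rewrite fsfunE inE eqxx.
have sw : finsupp w = [fset P]%fset.
  apply/fsetP => Q; rewrite mem_finsupp fsfunE !inE.
  by case: ifP; rewrite ?oner_eq0 ?eqxx.
have w0 Q : 0 <= w Q by rewrite fsfunE; case: ifP.
have w1 : \sum_(Q <- finsupp w) w Q = 1 by rewrite sw big_seq_fset1.
exists (msize P), (RPoly w0 w1) => [a|Q] /=.
  by rewrite /Pr /= sw big_mkcond big_seq_fset1 exact_polyE eqxx.
by rewrite sw inE => /eqP->; rewrite /deg_le leqW.
Qed.

Lemma pdegP (R : realType) (F : fieldType) (n : nat) (eps : R)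
    (f : boolfun n) : 0 <= eps ->
  pdeg_le F eps f (pdeg F eps f) /\
  forall e, pdeg_le F eps f e -> (pdeg F eps f <= e)%N.
Proof.
move=> /(pdeg_le_ex F f)[d0 d0P]; rewrite /pdeg.
case: xgetP => [d _ //|/(_ _) noleast]; exfalso.
have ex : exists d, `[< pdeg_le F eps f d >] by exists d0; apply/asboolP.
case: (ex_minnP ex) => d /asboolP dP dmin.
by apply: (noleast d); split => // e /asboolP; apply: dmin.
Qed.

Definition log2 (R : realType) (x : R) : R := ln x / ln 2.

(* With $c>0$ and $k$ fixed, [c * y / log2 n ^+ k <= x] for all large [n] is
   $x=\widetilde\Omega(y)$. *)
Definition tOmega (R : realType) (c : R) (k n : nat) (x y : R) : Prop :=
  c * y / log2 n%:R ^+ k <= x.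

(* Main.v *)
Require Import Defs.
From HB Require Import structures.
From mathcomp Require Import all_boot all_order all_algebra all_field finmap.
From mathcomp Require Import mpoly.
From mathcomp Require Import boolp reals sequences exp.
From mathcomp Require Import zify ring lra.
Import Order.TTheory GRing.Theory Num.Theory.
Local Open Scope ring_scope.
Set Implicit Arguments.
Unset Strict Implicit.
Unset Printing Implicit Defensive.

(** Let P be a random polynomial for a symmetric f.  Substituting constants and
    taking products of a logarithmic number of shifted copies of P (or of 1 - P),
    one obtains a polynomial on a cube of dimension 2k that tests whether the
    weight equals k, on a window of weights around k, or modulo the period b:
    every shift is chosen to halve the set of weights that are still confused
    with k, and the minimality of per(g) provides such shifts in the middle third.
    Averaging yields one polynomial T of degree d, wrong on a small set S only.
    The polynomials of degree at most D <= k restrict to the layer k with rank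
    C(2k, D) over every field; hence if |S| < C(2k, D), some Q of degree D
    vanishes on S but not on the layer k, and T * Q is a nonzero function
    supported on the layers that T accepts.  Such a function has degree at least
    k in three cases: if no accepted layer lies above k, if none lies below k, or
    if all accepted weights are congruent to k modulo a prime q different from
    the characteristic (multiply by om ^ weight, om a q-th root of unity).  So
    d >= k - D, and estimates of binomial coefficients give d^2 = Omega(k log(1/eps))
    once the error is polynomially small, which costs a logarithmic factor.
    Small windows, of size b^2 / log(1/eps), give the bound by per(g); for h the
    layer B(h) - 1 already has only zeros on one side. *)

(** * Functions of bounded degree on the recursive Boolean cube *)

(** Nested pairs rather than finite functions, so that an induction on the dimension peels off the
    first bit by computation. *)
Fixpoint hcube (m : nat) : finType :=
  if m is m'.+1 then (bool * hcube m')%type else unit.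

Fixpoint wt (m : nat) : hcube m -> nat :=
  if m is m'.+1 then fun y : hcube m'.+1 => (y.1 + wt y.2)%N else fun=> 0%N.

Section Degree.
Variable F : fieldType.

(* A function of degree at most [d] on the cube, recursively in the first bit:
   [phi(false, _)] has degree at most [d] and the difference
   [phi(true, _) - phi(false, _)] degree at most [d - 1] (and is 0 if [d = 0]). *)
Fixpoint degle (m : nat) : nat -> (hcube m -> F) -> Prop :=
  if m is m'.+1 then fun d (phi : hcube m'.+1 -> F) =>
    degle d (fun y => phi (false, y)) /\
    (if d is d'.+1 then degle d' (fun y => phi (true, y) - phi (false, y))
     else forall y, phi (true, y) = phi (false, y))
  else fun _ _ => True.

Lemma eq_degle m d (phi psi : hcube m -> F) :
  phi =1 psi -> degle d phi -> degle d psi.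
Proof. by move=> /funext->. Qed.

Lemma degle0 m d : degle d (fun _ : hcube m => 0).
Proof.
elim: m d => [//|m IH] [|d] /=; split => //.
by apply: eq_degle (IH d) => y; rewrite subrr.
Qed.

Lemma degle_cst m d c : degle d (fun _ : hcube m => c).
Proof.
elim: m d => [//|m IH] [|d] /=; split => //.
by apply: eq_degle (degle0 m d) => y; rewrite subrr.
Qed.

Lemma degle_mono m d e (phi : hcube m -> F) :
  (d <= e)%N -> degle d phi -> degle e phi.
Proof.
elim: m d e phi => [//|m IH] d e phi le_de [H0 H1]; split; first exact: IH H0.
case: d e le_de H0 H1 => [|d] [|e] //= le_de _ H1; last exact: IH H1.
by apply: eq_degle (degle0 m e) => y; rewrite H1 subrr.
Qed.

Lemma degleD m d (phi psi : hcube m -> F) :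
  degle d phi -> degle d psi -> degle d (fun y => phi y + psi y).
Proof.
elim: m d phi psi => [//|m IH] d phi psi [P0 P1] [Q0 Q1].
split; first exact: IH P0 Q0.
case: d P1 Q1 {P0 Q0} => [|d] P1 Q1 => [y|]; first by rewrite P1 Q1.
by apply: eq_degle (IH _ _ _ P1 Q1) => y; rewrite opprD addrACA.
Qed.

Lemma degleM m d e (phi psi : hcube m -> F) :
  degle d phi -> degle e psi -> degle (d + e) (fun y => phi y * psi y).
Proof.
elim: m d e phi psi => [//|m IH] d e phi psi [P0 P1] [Q0 Q1].
split; first exact: IH P0 Q0.
(* The product rule for differences in the first bit has one factor taken at [true] and the other at
   [false], so [phi (true, _)] needs a degree bound as well. *)
have phi1 : degle d (fun y => phi (true, y)).
  case: d P0 P1 => [|d] P0 P1; first by apply: eq_degle P0 => y; rewrite P1.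
  apply: eq_degle (degleD P0 (degle_mono (leqnSn d) P1)) => y.
  by rewrite addrC subrK.
case: d e P0 P1 Q0 Q1 phi1 => [|d] [|e] P0 P1 Q0 Q1 phi1.
- by rewrite addn0 => y; rewrite P1 Q1.
- rewrite addnS; apply: eq_degle (IH _ _ _ _ P0 Q1) => y.
  by rewrite P1; ring.
- rewrite addSn; apply: eq_degle (IH _ _ _ _ P1 Q0) => y.
  by rewrite Q1; ring.
- have R1 := IH _ _ _ _ phi1 Q1; rewrite addSnnS in R1.
  by apply: eq_degle (degleD R1 (IH _ _ _ _ P1 Q0)) => y; ring.
Qed.

Lemma degleZ m d c (phi : hcube m -> F) : degle d phi -> degle d (fun y => c * phi y).
Proof. exact: (degleM (degle_cst m 0 c)). Qed.

Lemma degleB m d (phi psi : hcube m -> F) :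
  degle d phi -> degle d psi -> degle d (fun y => phi y - psi y).
Proof.
move=> P Q; apply: eq_degle (degleD P (degleZ (-1) Q)) => y.
by rewrite mulN1r.
Qed.

Lemma degle_sum m d (I : Type) (r : seq I) (A : pred I) (phi : I -> hcube m -> F) :
  (forall i, A i -> degle d (phi i)) -> degle d (fun y => \sum_(i <- r | A i) phi i y).
Proof.
move=> H; elim: r => [|i r IH].
  by apply: eq_degle (degle0 m d) => y; rewrite big_nil.
case Ai: (A i); last by apply: eq_degle IH => y; rewrite big_cons Ai.
by apply: eq_degle (degleD (H i Ai) IH) => y; rewrite big_cons Ai.
Qed.

Lemma degle_prod m (I : Type) (r : seq I) (A : pred I) (e : I -> nat)
    (phi : I -> hcube m -> F) :
  (forall i, A i -> degle (e i) (phi i)) ->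
  degle (\sum_(i <- r | A i) e i) (fun y => \prod_(i <- r | A i) phi i y).
Proof.
move=> H; elim: r => [|i r IH].
  by apply: eq_degle (degle_cst m _ 1) => y; rewrite big_nil.
rewrite big_cons; case Ai: (A i).
  by apply: eq_degle (degleM (H i Ai) IH) => y; rewrite big_cons Ai.
by apply: eq_degle IH => y; rewrite big_cons Ai.
Qed.

Lemma degle_exp m d k (phi : hcube m -> F) :
  degle d phi -> degle (k * d) (fun y => phi y ^+ k).
Proof.
move=> H; elim: k => [|k IH]; first exact: degle_cst.
by rewrite mulSn; apply: eq_degle (degleM H IH) => y; rewrite exprS.
Qed.

Lemma degle_true m d (phi : hcube m.+1 -> F) :
  degle d phi -> degle d (fun y => phi (true, y)).
Proof.
move=> [P0 P1]; case: d P0 P1 => [|d] P0 P1.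
  by apply: eq_degle P0 => y; rewrite P1.
apply: eq_degle (degleD P0 (degle_mono (leqnSn d) P1)) => y.
by rewrite addrC subrK.
Qed.

(** The difference in the first bit lowers the degree and keeps the bound [k] on the support, so it
    vanishes by induction. The half with first bit 1 then keeps the degree and has its support bound
    lowered to [k - 1]. *)
Lemma degle_gt_support m d k (phi : hcube m -> F) :
  degle d phi -> (forall y, (k < wt y)%N -> phi y = 0) -> (d + k < m)%N ->
  forall y, phi y = 0.
Proof.
elim: m d k phi => [//|m IH] d k phi H supp lt_m.
have E y : phi (true, y) = phi (false, y).
  case: d H lt_m => [|d] [_ H1] lt_m; first exact: H1.
  apply/eqP; rewrite -subr_eq0; apply/eqP; apply: (IH _ _ _ H1 _ lt_m).
  by move=> z kz; rewrite !supp ?subrr //=; lia.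
have Z y : phi (true, y) = 0.
  case: k supp lt_m => [|k] supp lt_m; first by rewrite supp //=; lia.
  apply: (IH d k (fun y => phi (true, y)) (degle_true H)); last by lia.
  by move=> z kz; rewrite supp //=; lia.
by case=> -[] y; rewrite -?E Z.
Qed.

(** The half with first bit 0 inherits both bounds, and the difference in the first bit lowers both
    by one, so both vanish by induction. *)
Lemma degle_lt_support m d k (phi : hcube m -> F) :
  degle d phi -> (forall y, (wt y < k)%N -> phi y = 0) -> (d < k)%N ->
  forall y, phi y = 0.
Proof.
elim: m d k phi => [|m IH] d k phi H supp lt_k.
  by move=> y; apply: supp; exact: leq_ltn_trans (leq0n d) lt_k.
have Z y : phi (false, y) = 0.
  apply: (IH d k (fun y => phi (false, y)) H.1) => // z kz.
  by rewrite supp.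
have E y : phi (true, y) = phi (false, y).
  case: d H lt_k => [|d] [_ H1] lt_k; first exact: H1.
  apply/eqP; rewrite -subr_eq0; apply/eqP; apply: (IH d k.-1 _ H1); last by lia.
  by move=> z kz; rewrite !supp ?subrr //=; lia.
by case=> -[] y; rewrite ?E Z.
Qed.

(* Both [phi] and [psi] may be differentiated in the first bit, which shows that
   [phi(true, _)] equals [phi(false, _)] as well as [om * phi(false, _)]. *)
Lemma degle_twist m d e (om : F) (phi psi : hcube m -> F) :
  om != 1 -> degle d phi -> degle e psi ->
  (forall y, phi y = om ^+ wt y * psi y) -> (d + e < m)%N ->
  forall y, phi y = 0.
Proof.
move=> om1; elim: m d e phi psi => [//|m IH] d e phi psi Hphi Hpsi H lt_m.
have E y : phi (true, y) = phi (false, y).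
  case: d Hphi lt_m => [|d] [_ H1] lt_m; first exact: H1.
  apply/eqP; rewrite -subr_eq0; apply/eqP.
  apply: (IH d e _ _ H1 (degleB (degleZ om (degle_true Hpsi)) Hpsi.1)); last by lia.
  by move=> z; rewrite !H /= add1n add0n exprS; ring.
have E' y : phi (true, y) = om * phi (false, y).
  case: e Hpsi lt_m => [|e] [_ H1] lt_m.
    by rewrite !H /= H1 add1n add0n exprS mulrA.
  apply/eqP; rewrite -subr_eq0; apply/eqP.
  apply: (IH d e _ _ (degleB (degle_true Hphi) (degleZ om Hphi.1)) (degleZ om H1)); last by lia.
  by move=> z; rewrite !H /= add1n add0n exprS; ring.
have Z y : phi (false, y) = 0.
  apply/eqP; have /eqP := E' y; rewrite E -subr_eq0 -[X in X - _]mul1r -mulrBl mulf_eq0.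
  by rewrite subr_eq0 eq_sym (negPf om1).
by case=> -[] y; rewrite ?E Z.
Qed.

End Degree.

Lemma wt_le m (y : hcube m) : (wt y <= m)%N.
Proof. by elim: m y => [//|m IH] [b y] /=; have := IH y; case: b => /=; lia. Qed.

Lemma wt_exists m k : (k <= m)%N -> exists y : hcube m, wt y = k.
Proof.
elim: m k => [|m IH] [|k] // le_km; first by exists tt.
  by have [y wy] := IH 0%N isT; exists (false, y).
by have [y wy] := IH k le_km; exists (true, y); rewrite /= wy.
Qed.

(** * Rank of low-degree functions on one layer of the cube *)

Section Slice.
Variable F : fieldType.

(** Linear independence is required of the restrictions to the layer [k], so the size of [I] is a
    lower bound for the rank there. *)
Definition slice_family (m D k : nat) (I : finType) (Phi : I -> hcube m -> F) :=
  (forall i, degle D (Phi i)) /\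
  (forall c : I -> F, (forall y, wt y = k -> \sum_i c i * Phi i y = 0) ->
     forall i, c i = 0).

(** The inductive step along Pascal's rule. The second family is multiplied by the indicator of
    first bit [b0]; on the other half only the first family survives, which kills its coefficients,
    and then the half [b0] kills the rest. *)
Lemma slice_family_glue m D k k1 k2 (b0 : bool) (I1 I2 : finType)
    (Phi1 : I1 -> hcube m -> F) (Phi2 : I2 -> hcube m -> F) :
  (~~ b0 + k1 = k)%N -> (b0 + k2 = k)%N ->
  slice_family D.+1 k1 Phi1 -> slice_family D k2 Phi2 ->
  exists Phi : (I1 + I2)%type -> hcube m.+1 -> F, slice_family D.+1 k Phi.
Proof.
move=> e1 e2 [d1 f1] [d2 f2].
exists (fun i y => match i with
  | inl i => Phi1 i y.2 | inr i => (y.1 == b0)%:R * Phi2 i y.2 end).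
split=> [[i|i]|c Hc].
- split=> /=; first exact: d1.
  by apply: eq_degle (degle0 F m D) => y; rewrite subrr.
- split; first exact: (degle_mono (leqnSn D) (degleZ _ (d2 i))).
  apply: eq_degle (degleZ ((true == b0)%:R - (false == b0)%:R) (d2 i)) => y.
  by rewrite mulrBl.
have c1 i : c (inl i) = 0.
  apply: (f1 (fun i => c (inl i))) => y wy.
  have := Hc (~~ b0, y); rewrite /= wy e1 => /(_ erefl).
  rewrite big_sumType /= [X in _ + X]big1 ?addr0 // => j _.
  by case: b0 {Hc e1 e2} => /=; rewrite mul0r mulr0.
have c2 i : c (inr i) = 0.
  apply: (f2 (fun i => c (inr i))) => y wy.
  have := Hc (b0, y); rewrite /= wy e2 => /(_ erefl).
  rewrite big_sumType /= big1 ?add0r => [H|j _]; last by rewrite c1 mul0r.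
  by rewrite -[RHS]H; apply: eq_bigr => j _; rewrite eqxx mul1r.
by case=> i.
Qed.

(* For [D < k] the top bit is split off as [1 - x], for [D = k] as [x]:
   in both cases the parameters of the two halves stay in range. *)
Lemma slice_family_exists m D k : (D <= k)%N -> (k + D <= m)%N || (D == k) ->
  exists (I : finType) (Phi : I -> hcube m -> F),
    #|I| = 'C(m, D) /\ slice_family D k Phi.
Proof.
elim: m D k => [|m IH] [|D] k leDk cond.
- have k0 : k = 0%N by lia.
  exists unit, (fun _ _ => 1); rewrite card_unit bin0; split=> //; split=> // c Hc [].
  by have := Hc tt; rewrite k0 => /(_ erefl); rewrite (bigD1 tt) //= mulr1 big1 ?addr0 // => -[].
- exists 'I_0, (fun _ _ => 0); rewrite card_ord; split=> //.
  by split=> [[]|c _ []].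
- exists unit, (fun _ _ => 1); rewrite card_unit bin0; split=> //; split=> [i|c Hc []].
    exact: degle_cst.
  have [y wy] : exists y : hcube m.+1, wt y = k by apply: wt_exists; lia.
  by have := Hc y wy; rewrite (bigD1 tt) //= mulr1 big1 ?addr0 // => -[].
have [b0 [k1 [k2 [e1 e2 c1 c2]]]] : exists (b0 : bool) k1 k2,
    [/\ (~~ b0 + k1 = k)%N, (b0 + k2 = k)%N,
      (D.+1 <= k1)%N && ((k1 + D.+1 <= m)%N || (D.+1 == k1)) &
      (D <= k2)%N && ((k2 + D <= m)%N || (D == k2))].
  case: (eqVneq D.+1 k) cond leDk => [<-|ne] cond leDk.
    by exists true, D.+1, D; split => //=; lia.
  by exists false, k.-1, k; split => //=; lia.
have [I1 [Phi1 [card1 fam1]]] := IH D.+1 k1 (proj1 (andP c1)) (proj2 (andP c1)).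
have [I2 [Phi2 [card2 fam2]]] := IH D k2 (proj1 (andP c2)) (proj2 (andP c2)).
have [Phi fam] := slice_family_glue e1 e2 fam1 fam2.
exists (I1 + I2)%type, Phi; split=> //.
by rewrite card_sum card1 card2 binS.
Qed.

Lemma exists_annihilating_combination (T I : finType) (S : {set T}) (Phi : I -> T -> F) :
  (#|S| < #|I|)%N -> exists2 c : I -> F, exists i, c i != 0 &
    forall y, y \in S -> \sum_i c i * Phi i y = 0.
Proof.
move=> lt_SI.
pose M := \matrix_(i < #|I|, j < #|S|) Phi (enum_val i) (enum_val j).
have : kermx M != 0.
  rewrite -mxrank_eq0 mxrank_ker -lt0n subn_gt0.
  exact: leq_ltn_trans (rank_leq_col M) lt_SI.
case/rowV0Pn => v /sub_kermxP vM v0.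
exists (fun i => v 0 (enum_rank i)) => [|y yS].
  have [i vi] : exists i, v 0 i != 0.
    apply/existsP; rewrite -[X in is_true X]negbK negb_exists.
    apply: contraNN v0 => /forallP H; apply/eqP/rowP => i.
    by have := H i; rewrite negbK => /eqP->; rewrite mxE.
  by exists (enum_val i); rewrite enum_valK.
have /rowP/(_ (enum_rank_in yS y)) := vM; rewrite !mxE => H.
rewrite -[RHS]H (reindex (@enum_val I predT)) /=; last first.
  by exists enum_rank => i _; rewrite ?enum_valK ?enum_rankK.
by apply: eq_bigr => i _; rewrite !mxE enum_valK enum_rankK_in.
Qed.

Lemma slice_separation m D k (S : {set hcube m}) : (D <= k)%N -> (k + D <= m)%N ->
  (#|S| < 'C(m, D))%N -> exists Q : hcube m -> F,
  [/\ degle D Q, forall y, y \in S -> Q y = 0 &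
      exists y, wt y = k /\ Q y != 0].
Proof.
move=> leDk lekm ltS.
have [|I [Phi [cardI [dPhi fPhi]]]] := @slice_family_exists m D k leDk; first by rewrite lekm.
rewrite -cardI in ltS.
have [c [i ci] cS] := exists_annihilating_combination Phi ltS.
exists (fun y => \sum_i c i * Phi i y); split => //.
  by apply: degle_sum => j _; apply: degleZ.
apply: contrapT => H; case/eqP: ci; apply: fPhi => y wy.
by apply: contrapT => /eqP ne; apply: H; exists y.
Qed.

Lemma exists_slice_multiple m D k d (S : {set hcube m}) (P : hcube m -> F) :
  (D <= k)%N -> (k + D <= m)%N -> (#|S| < 'C(m, D))%N -> degle d P ->
  (forall y, y \notin S -> wt y = k -> P y != 0) ->
  exists phi : hcube m -> F, [/\ degle (d + D) phi,
    forall y, y \in S \/ P y = 0 -> phi y = 0 & exists y, phi y != 0].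
Proof.
move=> leDk lekm ltS dP PS.
have [Q [dQ QS [y [wy Qy]]]] := slice_separation leDk lekm ltS.
exists (fun y => P y * Q y); split; first exact: degleM.
  by move=> z [/QS->|->]; rewrite ?mulr0 ?mul0r.
exists y; rewrite mulf_neq0 // PS //.
by apply: contraNN Qy => /QS->.
Qed.

End Slice.

(** * Roots of unity and functions supported on one residue class *)

(** Adjoin a root of an irreducible factor of 1 + X + ... + X^(q-1). It differs from 1 because this
    polynomial takes the value q, nonzero in [F], at 1. *)
Lemma nontrivial_root_of_unity (F : fieldType) (q : nat) :
  prime q -> (q%:R : F) != 0 ->
  exists (L : fieldExtType F) (om : L), om != 1 /\ om ^+ q = 1.
Proof.
move=> q_pr q0.
pose p : {poly F} := \sum_(i < q) 'X^i.
have eq_p : ('X - 1) * p = 'X^q - 1 by rewrite subrX1.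
have size_p : size p = q.
  have -> : p = \poly_(i < q) 1.
    by rewrite poly_def; apply: eq_bigr => i _; rewrite scale1r.
  by rewrite size_poly_eq // oner_eq0.
have p0 : p != 0 by rewrite -size_poly_gt0 size_p prime_gt0.
(* Descent on the size: a divisor that is not irreducible has a smaller nonconstant divisor. *)
have irr_dvd n (r : {poly F}) : (size r <= n)%N -> r %| p -> (1 < size r)%N ->
    exists s : {poly F}, s %| p /\ irreducible_poly s.
  elim: n r => [|n IH] r le_n rp gt1; first by have := leq_trans gt1 le_n.
  have [irr|/not_andP[//|]] := pselect (irreducible_poly r); first by exists r.
  move=> /existsNP[s] /not_implyP[s1] /not_implyP[sr] /negP ns.
  have r0 : r != 0 by apply: contraNneq p0 => r0; move: rp; rewrite r0 dvd0p.
  have s0 : s != 0 by apply: contraNneq r0 => s0; move: sr; rewrite s0 dvd0p.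
  have lt_sr : (size s < size r)%N.
    rewrite ltn_neqAle dvdp_leq // andbT; apply: contra ns => e.
    by rewrite -dvdp_size_eqp.
  apply: (IH s); [exact: leq_trans lt_sr le_n|exact: dvdp_trans sr rp|].
  by rewrite ltn_neqAle eq_sym s1 lt0n size_poly_eq0.
have [s [sp irr]] : exists s : {poly F}, s %| p /\ irreducible_poly s.
  by apply: (irr_dvd _ p (leqnn _) (dvdpp p)); rewrite size_p prime_gt1.
have [L dimL [z rz _]] := irredp_FAdjoin irr.
exists L, z.
have rpz : root (map_poly (in_alg L) p) z.
  case/dvdpP: sp => t ->; rewrite rmorphM /= rootM rz orbT //.
split.
  apply: contraTneq rpz => ->; rewrite rmorph_sum /= rootE horner_sum.
  rewrite (eq_bigr (fun=> 1)) => [|i _].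
    by rewrite sumr_const card_ord -(rmorph_nat (in_alg L)) fmorph_eq0.
  by rewrite rmorphXn /= map_polyX hornerXn expr1n.
have := congr1 (fun p => (map_poly (in_alg L) p).[z]) eq_p.
rewrite rmorphM /= hornerM (eqP (rpz : root _ _)) mulr0.
rewrite rmorphB /= rmorphXn /= map_polyX rmorph1 hornerD hornerN hornerC hornerXn.
by move/esym/eqP; rewrite subr_eq0 => /eqP.
Qed.

Lemma degle_map (F L : fieldType) (h : {rmorphism F -> L}) m d (phi : hcube m -> F) :
  degle d phi -> degle d (fun y => h (phi y)).
Proof.
elim: m d phi => [//|m IH] d phi [P0 P1]; split; first exact: IH P0.
case: d P0 P1 => [|d] P0 P1; first by move=> y; rewrite P1.
by apply: eq_degle (IH _ _ P1) => y; rewrite rmorphB.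
Qed.

(** On the support of [phi] the factor [om ^+ wt y] is the constant [om ^+ k], so [phi] is its own
    twist up to a scalar and [degle_twist] applies with both degrees equal to [d]. *)
Lemma degle_residue_support (F : fieldType) m d k q (phi : hcube m -> F) :
  prime q -> (q%:R : F) != 0 -> degle d phi ->
  (forall y, wt y != k %[mod q] -> phi y = 0) -> (d + d < m)%N ->
  forall y, phi y = 0.
Proof.
move=> q_pr q0 dphi supp lt_m y.
have [L [om [om1 omq]]] := nontrivial_root_of_unity q_pr q0.
have om0 : om != 0.
  by apply: contraTneq (oner_neq0 L) => om0; rewrite -omq om0 expr0n (gtn_eqF (prime_gt0 q_pr)) eqxx.
pose h := GRing.in_alg L.
apply: (fmorph_inj h); rewrite rmorph0.
have dh := degle_map h dphi.
apply: (degle_twist om1 dh (degleZ (om ^- k) dh)) => // z.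
have [e|ne] := eqVneq (wt z %% q)%N (k %% q)%N; last by rewrite supp // rmorph0 !mulr0.
rewrite -(expr_mod (wt z) omq) -(expr_mod k omq) e.
by rewrite mulrA divff ?mul1r // expf_neq0.
Qed.

(** * Degree bounds for functions that isolate a layer outside a small error set *)

Section Key.
Variable F : fieldType.

Lemma degree_ge_above m D k d (S : {set hcube m}) (P : hcube m -> F) :
  (D <= k)%N -> (k + D <= m)%N -> (#|S| < 'C(m, D))%N -> degle d P ->
  (forall y, y \notin S -> wt y = k -> P y != 0) ->
  (forall y, y \notin S -> (k < wt y)%N -> P y = 0) ->
  (m - k <= d + D)%N.
Proof.
move=> leDk lekm ltS dP PS P0.
have [phi [dphi phi0 [y]]] := exists_slice_multiple leDk lekm ltS dP PS.
apply: contraNT; rewrite -ltnNge ltn_subRL addnC => lt; apply/eqP; move: y.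
apply: (degle_gt_support dphi _ lt) => z kz; apply: phi0.
by have [?|?] := boolP (z \in S); [left|right; apply: P0].
Qed.

Lemma degree_ge_below m D k d (S : {set hcube m}) (P : hcube m -> F) :
  (D <= k)%N -> (k + D <= m)%N -> (#|S| < 'C(m, D))%N -> degle d P ->
  (forall y, y \notin S -> wt y = k -> P y != 0) ->
  (forall y, y \notin S -> (wt y < k)%N -> P y = 0) ->
  (k <= d + D)%N.
Proof.
move=> leDk lekm ltS dP PS P0.
have [phi [dphi phi0 [y]]] := exists_slice_multiple leDk lekm ltS dP PS.
apply: contraNT; rewrite -ltnNge => lt; apply/eqP; move: y.
apply: (degle_lt_support dphi _ lt) => z kz; apply: phi0.
by have [?|?] := boolP (z \in S); [left|right; apply: P0].
Qed.

Lemma degree_ge_residue m D k d q (S : {set hcube m}) (P : hcube m -> F) :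
  prime q -> (q%:R : F) != 0 ->
  (D <= k)%N -> (k + D <= m)%N -> (#|S| < 'C(m, D))%N -> degle d P ->
  (forall y, y \notin S -> wt y = k -> P y != 0) ->
  (forall y, y \notin S -> wt y != k %[mod q] -> P y = 0) ->
  (m <= (d + D) + (d + D))%N.
Proof.
move=> q_pr q0 leDk lekm ltS dP PS P0.
have [phi [dphi phi0 [y]]] := exists_slice_multiple leDk lekm ltS dP PS.
apply: contraNT; rewrite -ltnNge => lt; apply/eqP; move: y.
apply: (@degle_residue_support _ _ _ k _ _ q_pr q0 dphi _ lt) => z kz; apply: phi0.
by have [?|?] := boolP (z \in S); [left|right; apply: P0].
Qed.

End Key.

(** * Affine substitutions from a small cube *)

Fixpoint bit (m : nat) : hcube m -> nat -> bool :=
  if m is m'.+1 then fun (y : hcube m'.+1) j => if j is j'.+1 then bit y.2 j' else y.1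
  else fun _ _ => false.

Lemma sum_bit m (y : hcube m) : (\sum_(0 <= j < m) bit y j)%N = wt y.
Proof.
elim: m y => [|m IH] y; first by rewrite big_nil.
by rewrite big_nat_recl //= IH.
Qed.

Lemma degle_bit (F : fieldType) m j : degle 1 (fun y : hcube m => (bit y j)%:R : F).
Proof.
elim: m j => [//|m IH] [|j]; split => /=.
- exact: degle0.
- by apply: eq_degle (degle_cst m 0 (1 : F)) => y; rewrite subr0.
- exact: IH.
- by apply: eq_degle (degle0 F m 0) => y; rewrite subrr.
Qed.

(* The first [m] coordinates are free, the next [s] are set to 1, the others to 0. *)
Definition shift n m s (y : hcube m) : cube n :=
  [ffun j : 'I_n => if (j < m)%N then bit y j else (j < m + s)%N].

Lemma weight_shift n m s (y : hcube m) : (m + s <= n)%N -> weight (shift n s y) = (wt y + s)%N.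
Proof.
move=> le_n; rewrite /weight -sum1_card.
transitivity (\sum_(0 <= j < n) (if j < m then bit y j else j < m + s))%N.
  rewrite big_mkord big_mkcond /=; apply: eq_bigr => j _.
  by rewrite inE ffunE; case: (j < m)%N; [case: (bit y j)|case: (_ < _)%N].
rewrite (@big_cat_nat _ _ _ (m + s)) //= (@big_cat_nat _ _ _ m) ?leq_addr //=.
rewrite [X in (_ + X)%N]big_nat_cond [X in (_ + X)%N]big1 ?addn0; last first.
  by move=> i /andP[/andP[le _] _]; rewrite !ltnNge le (leq_trans (leq_addr s m) le).
congr addn.
  by rewrite -[RHS]sum_bit; apply: eq_big_nat => i /andP[_ ->].
rewrite -{1}[m]add0n big_addn addKn -[RHS](subn0 s) -[RHS]muln1 -sum_nat_const_nat.
by apply: eq_big_nat => i /andP[_ lt_s]; rewrite ltnNge leq_addl /= addnC ltn_add2l lt_s.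
Qed.

Lemma degle_shift (F : fieldType) n m s (j : 'I_n) :
  degle 1 (fun y : hcube m => (shift n s y j)%:R : F).
Proof.
have [lt|ge] := ltnP j m.
  by apply: eq_degle (degle_bit F m j) => y; rewrite ffunE lt.
apply: eq_degle (degle_cst m 1 ((j < m + s)%N%:R : F)) => y.
by rewrite ffunE (ltnNge j m) ge.
Qed.

Lemma Spec_shift n m s (f : boolfun n) (y : hcube m) : symfun f -> (m + s <= n)%N ->
  f (shift n s y) = Spec f (wt y + s)%N.
Proof. by move=> sf le_n; rewrite (SpecE _ sf) weight_shift. Qed.

(* Degree at most [d], tested through all affine substitutions from a cube. *)
Definition lowdeg (F : fieldType) n d (phi : cube n -> F) : Prop :=
  forall m (rho : hcube m -> cube n),
    (forall j, degle 1 (fun y => (rho y j)%:R : F)) -> degle d (fun y => phi (rho y)).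

Lemma lowdeg_peval (F : fieldType) n d (P : {mpoly F[n]}) :
  deg_le d P -> lowdeg d (peval P).
Proof.
move=> dP m rho Hrho; rewrite /peval.
apply: (@eq_degle _ _ _ (fun y => \sum_(M <- msupp P | M \in msupp P)
    P@_M * \prod_(i < n) ((rho y i)%:R) ^+ M i)) => [y|].
  by rewrite mevalE big_seq.
apply: degle_sum => M MP; apply: degleZ.
apply: (@degle_mono _ _ (\sum_(i < n) M i * 1)).
  under eq_bigr do rewrite muln1.
  by rewrite -mdegE -ltnS; apply: leq_trans dP; apply: msize_mdeg_lt.
by apply: degle_prod => i _; apply: degle_exp.
Qed.

(** * Random low-degree functions and averaging *)

Section Approx.
Variables (R : realType) (F : fieldType).

(** A probabilistic polynomial reduced to a finite distribution on low-degree functions of the cube,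
    so that majority votes and xor can be formed pointwise. *)
Definition approx n d (err : R) (f : boolfun n) : Prop :=
  exists (I : finType) (w : I -> R) (phi : I -> cube n -> F),
  [/\ forall i, 0 <= w i, \sum_i w i = 1, forall i, lowdeg d (phi i) &
      forall a, \sum_(i | phi i a != (f a)%:R) w i <= err].

Lemma pdeg_le_approx n d eps (f : boolfun n) : pdeg_le F eps f d -> approx d eps f.
Proof.
case=> mu Hmu dmu.
exists (finsupp (rweight mu)), (fun i => rweight mu (val i)), (fun i => peval (val i)).
split.
- by move=> i; apply: rweight_ge0.
- by rewrite -(rweight_sum1 mu) big_seq_fsetE.
- by move=> i; apply/lowdeg_peval/dmu/valP.
- by move=> a; apply: le_trans (Hmu a); rewrite /Pr big_seq_fsetE.
Qed.

(** By the union bound over [T], the right-hand side bounds the expected number of points at which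
    some test errs; an index doing no worse than average exists because the weights sum to 1. *)
Lemma approx_derandomize n d err (f : boolfun n) (T : seq nat) (Y : finType)
    (rho : nat -> Y -> cube n) : approx d err f ->
  exists2 phi : cube n -> F, lowdeg d phi &
  #|[set y | has (fun s => phi (rho s y) != (f (rho s y))%:R) T]|%:R
    <= (size T)%:R * err * #|Y|%:R.
Proof.
case=> I [w [phi [w0 w1 dphi ephi]]].
pose S i := [set y | has (fun s => phi i (rho s y) != (f (rho s y))%:R) T].
have le_sum : \sum_i w i * #|S i|%:R <= (size T)%:R * err * #|Y|%:R.
  apply: (@le_trans _ _ (\sum_i \sum_(s <- T) \sum_(y : Y)
      (if phi i (rho s y) != (f (rho s y))%:R then w i else 0))).
    apply: ler_sum => i _.
    rewrite exchange_big /= -sum1_card natr_sum mulr_sumr big_mkcond /=.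
    apply: ler_sum => y _; rewrite inE mulr1.
    elim: T {S} => [|s T IH] /=; first by rewrite big_nil.
    rewrite big_cons; case: (_ != _) => /=; last by rewrite add0r; exact: IH.
    by rewrite lerDl sumr_ge0 // => t _; case: ifP.
  rewrite exchange_big /=.
  under eq_bigr do rewrite exchange_big /=.
  rewrite -mulrA mulr_natl.
  apply: (@le_trans _ _ (\sum_(s <- T) err * #|Y|%:R)).
    apply: ler_sum => s _; rewrite mulr_natr -sumr_const.
    by apply: ler_sum => y _; rewrite -big_mkcond.
  by rewrite big_const_seq count_predT iter_addr_0.
apply: contrapT => H.
have gt i : (size T)%:R * err * #|Y|%:R < #|S i|%:R.
  by rewrite ltNge; apply/negP => le; apply: H; exists (phi i).
set B := _ * _ in le_sum gt.
have : \sum_i w i * (#|S i|%:R - B) <= 0.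
  under eq_bigr do rewrite mulrBr.
  by rewrite sumrB -mulr_suml w1 mul1r subr_le0.
have ge0 i : true -> 0 <= w i * (#|S i|%:R - B) by move=> _; rewrite mulr_ge0 // subr_ge0 ltW.
move=> le0; have /eqP : \sum_i w i * (#|S i|%:R - B) = 0.
  by apply/eqP; rewrite eq_le le0 sumr_ge0.
rewrite psumr_eq0 // => /allP z; have /eqP := w1; rewrite big1 ?(eq_sym 0) ?oner_eq0 // => i _.
have := z i (mem_index_enum i); rewrite mulf_eq0 subr_eq0 => /orP[/eqP//|/eqP e].
by have := gt i; rewrite e ltxx.
Qed.

End Approx.

(** * Error reduction by majority votes, and separating tests *)

Section Amplify.
Variables (R : realType) (F : fieldType).

Definition literal (b : bool) (z : F) : F := if b then z else 1 - z.

Lemma degle_literal m d b (phi : hcube m -> F) :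
  degle d phi -> degle d (fun y => literal b (phi y)).
Proof. by case: b => // H; apply: degleB => //; apply: degle_cst. Qed.

Lemma literal_bool (b c : bool) : literal b c%:R = (b == c)%:R.
Proof. by case: b c => -[]; rewrite /literal ?subr0 ?subrr. Qed.

(** The multilinear extension of the strict majority of [2 * u] bits, defined on arbitrary field
    elements. *)
Definition majority_poly u (z : 'I_(2 * u) -> F) : F :=
  \sum_(v : {ffun 'I_(2 * u) -> bool})
    (u < #|[set j | v j]|)%:R * \prod_j literal (v j) (z j).

(* Summing the weights of the other inputs to one, the extension only sees the
   correct inputs, so the wrong ones may even take non-Boolean values. *)
Lemma majority_polyE u (z : 'I_(2 * u) -> F) (b : bool) :
  (#|[set j | z j != b%:R]| < u)%N -> majority_poly z = b%:R.
Proof.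
move=> few; apply/eqP; rewrite -subr_eq0; apply/eqP.
have tot : \sum_(v : {ffun 'I_(2 * u) -> bool}) \prod_j literal (v j) (z j) = 1.
  rewrite -(bigA_distr_bigA (fun j b => literal b (z j))) big1 // => j _.
  by rewrite big_bool /= /literal addrC subrK.
have -> : majority_poly z - b%:R = \sum_(v : {ffun 'I_(2 * u) -> bool})
    ((u < #|[set j | v j]|)%:R - b%:R) * \prod_j literal (v j) (z j).
  by under eq_bigr do rewrite mulrBl; rewrite sumrB -mulr_sumr tot mulr1.
rewrite big1 // => v _.
have [->|ne] := eqVneq (u < #|[set j | v j]|)%N b; first by rewrite subrr mul0r.
have /existsP[j /andP[zj vj]] : [exists j, (z j == b%:R) && (v j != b)].
  apply: contraNT ne; rewrite negb_exists => /forallP H.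
  have sub : [set j | v j != b] \subset [set j | z j != b%:R].
    by apply/fintype.subsetP => j; rewrite !inE => vj; have := H j; rewrite vj andbT.
  have lt_u := leq_ltn_trans (subset_leq_card sub) few.
  case: b {few sub H} lt_u => lt_u.
    have := cardsC [set j | v j]; rewrite card_ord.
    have -> : ~: [set j | v j] = [set j | v j != true].
      by apply/setP => j; rewrite !inE eqb_id.
    by rewrite eqb_id; lia.
  rewrite eqbF_neg -leqNgt; apply: leq_trans (ltnW lt_u).
  by apply: subset_leq_card; apply/fintype.subsetP => j; rewrite !inE => ->.
rewrite [\prod_j _](bigD1 j) //= (eqP zj) literal_bool (negPf vj).
by rewrite mul0r mulr0.
Qed.

(** The majority of [2 * u] independent copies errs only if at least [u] of them do. Markov's
    inequality for 2 to the number of wrong copies bounds this by ((1 + 1/3)^2 / 2)^u. *)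
Lemma approx_amplify n d (eps : R) u (f : boolfun n) :
  eps <= 1 / 3 -> approx F d eps f -> approx F (2 * u * d) ((8 / 9 : R) ^+ u) f.
Proof.
move=> eps3 [I [w [phi [w0 w1 dphi ephi]]]].
pose wrong (g : {ffun 'I_(2 * u) -> I}) a := [set j | phi (g j) a != (f a)%:R].
exists {ffun 'I_(2 * u) -> I}, (fun g : {ffun _} => \prod_j w (g j)),
  (fun (g : {ffun _}) a => majority_poly (fun j => phi (g j) a)); split.
- by move=> g; apply: prodr_ge0.
- by rewrite -(bigA_distr_bigA (fun _ => w)) w1 big1.
- move=> g m rho Hrho; apply: degle_sum => v _; apply: degleZ.
  apply: (@degle_mono _ _ (\sum_(j < 2 * u) d)); first by rewrite sum_nat_const card_ord.
  by apply: degle_prod => j _; apply/degle_literal/dphi.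
move=> a.
have wr i : 0 <= w i * 2 ^+ (phi i a != (f a)%:R) by rewrite mulr_ge0 // exprn_ge0.
apply: (@le_trans _ _ (\sum_(g : {ffun 'I_(2 * u) -> I})
    \prod_j (w (g j) * 2 ^+ (phi (g j) a != (f a)%:R)) / 2 ^+ u)).
  rewrite big_mkcond; apply: ler_sum => g _; case: ifP => [bad|_]; last first.
    by rewrite divr_ge0 ?exprn_ge0 // prodr_ge0.
  rewrite big_split /= -mulrA ler_peMr ?prodr_ge0 //.
  rewrite prodrXr ler_pdivlMr ?exprn_gt0 // mul1r ler_weXn2l ?ler1n //.
  have -> : (\sum_(i < 2 * u) (phi (g i) a != (f a)%:R) = #|wrong g a|)%N.
    by rewrite -sum1_card [RHS]big_mkcond; apply: eq_bigr => j _; rewrite inE; case: (_ != _).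
  by rewrite leqNgt; apply: contra bad => few; rewrite (majority_polyE few).
rewrite -mulr_suml -(bigA_distr_bigA (fun _ i => w i * 2 ^+ (phi i a != (f a)%:R))).
rewrite prodr_const card_ord exprM -expr_div_n.
have le43 : \sum_i w i * 2 ^+ (phi i a != (f a)%:R) <= 4 / 3.
  have -> : \sum_i w i * 2 ^+ (phi i a != (f a)%:R)
      = 1 + \sum_(i | phi i a != (f a)%:R) w i.
    rewrite [X in _ + X]big_mkcond -[X in X + _]w1 -big_split /=; apply: eq_bigr => i _.
    by case: (_ != _) => /=; rewrite ?expr1 ?expr0 ?mulr1 ?addr0 // mulrDr mulr1.
  by have := le_trans (ephi a) eps3; lra.
have ge0 : 0 <= \sum_i w i * 2 ^+ (phi i a != (f a)%:R) by apply: sumr_ge0.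
have le89 : (\sum_i w i * 2 ^+ (phi i a != (f a)%:R)) ^+ 2 / 2 <= 8 / 9 by nra.
by apply: lerXn2r le89; rewrite nnegrE ?divr_ge0 ?exprn_ge0.
Qed.

End Amplify.

(* Each test kept splits the remaining candidates, and the smaller half survives. *)
Lemma splitting_tests (T : finType) (sigma : nat -> T -> bool) (V : nat -> Prop) (C : {set T}) :
  C != set0 ->
  (forall c c', c \in C -> c' \in C -> c != c' -> exists2 s, V s & sigma s c != sigma s c') ->
  exists (S : seq nat) c0, [/\ c0 \in C, (2 ^ size S <= #|C|)%N,
    forall s, s \in S -> V s &
    forall c, c \in C -> (forall s, s \in S -> sigma s c = sigma s c0) -> c = c0].
Proof.
have [N leN] := ubnP #|C|; elim: N C leN => // N IH C leN /set0Pn[c cC] sep.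
have [c' /andP[c'C ne]|single] := pickP (fun c' => (c' \in C) && (c' != c)); last first.
  exists [::], c; split => //; first by rewrite expn0 card_gt0; apply/set0Pn; exists c.
  by move=> e eC _; apply/eqP; have := single e; rewrite eC /= => /negbFE.
have [s Vs split_s] := sep _ _ c'C cC ne.
have [b small] : exists b, (#|[set e in C | sigma s e == b]|.*2 <= #|C|)%N.
  have := cardsID [set e | sigma s e] C.
  have -> : C :&: [set e | sigma s e] = [set e in C | sigma s e == true].
    by apply/setP => e; rewrite !inE eqb_id.
  have -> : C :\: [set e | sigma s e] = [set e in C | sigma s e == false].
    by apply/setP => e; rewrite !inE eqbF_neg andbC.
  move=> tot; case: (leqP #|[set e in C | sigma s e == true]| #|[set e in C | sigma s e == false]|) => le.
    by exists true; lia.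
  by exists false; lia.
set C' := [set e in C | _] in small.
have C'0 : C' != set0.
  apply/set0Pn; have [e|ne'] := eqVneq (sigma s c) b; [exists c|exists c'].
    by rewrite inE cC e eqxx.
  rewrite inE c'C /=; move: split_s ne'; case: (sigma s c') (sigma s c) (b) => -[] [] //.
have lt_C' : (#|C'| < N)%N.
  by rewrite -card_gt0 in C'0; lia.
have [S [c0 [c0C' sizeS VS uniqS]]] : exists (S : seq nat) c0,
    [/\ c0 \in C', (2 ^ size S <= #|C'|)%N, forall s, s \in S -> V s &
    forall c, c \in C' -> (forall s, s \in S -> sigma s c = sigma s c0) -> c = c0].
  apply: IH => // e e'; rewrite !inE => /andP[eC _] /andP[e'C _]; exact: sep.
move: c0C'; rewrite inE => /andP[c0C /eqP c0b].
exists (s :: S), c0; split => //.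
- by rewrite /= expnS mul2n; apply: leq_trans small; rewrite leq_double.
- by move=> t; rewrite inE => /orP[/eqP->|/VS].
move=> e eC He; apply: uniqS; first by rewrite inE eC He ?mem_head ?c0b /=.
by move=> t tS; apply: He; rewrite inE tS orbT.
Qed.

(** * Spectra, periods and the standard decomposition *)

Lemma weight_prefix n i : (i <= n)%N -> weight [ffun j : 'I_n => (j < i)%N] = i.
Proof. exact: (@weight_shift n 0 i tt). Qed.

Definition symfun_of n (sigma : nat -> bool) : boolfun n := [ffun a => sigma (weight a)].

Lemma symfun_of_sym n sigma : symfun (symfun_of n sigma).
Proof. by move=> a b; rewrite !ffunE => ->. Qed.

Lemma Spec_symfun_of n sigma i : (i <= n)%N -> Spec (symfun_of n sigma) i = sigma i.
Proof. by move=> le_in; rewrite /Spec ffunE weight_prefix. Qed.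

Lemma per_period n (g : boolfun n) : is_period g (per g).
Proof. by rewrite /per; case: ex_minnP. Qed.

Lemma per_le n (g : boolfun n) b : is_period g b -> (per g <= b)%N.
Proof. by rewrite /per; case: ex_minnP => m _; apply. Qed.

Lemma per_gt0 n (g : boolfun n) : (0 < per g)%N.
Proof. by have /andP[] := per_period g. Qed.

Lemma is_period_Spec n (g : boolfun n) b i j : is_period g b ->
  (i <= n)%N -> (j <= n)%N -> i = j %[mod b] -> Spec g i = Spec g j.
Proof.
case/andP=> b0 /forallP per_b.
suff mod_b k : (k <= n)%N -> Spec g k = Spec g (k %% b).
  by move=> le_in le_jn e; rewrite mod_b // e -mod_b.
move=> le_kn; have := le_kn; rewrite {1 2}(divn_eq k b).
elim: (k %/ b)%N => [|t IH]; first by rewrite add0n.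
rewrite mulSn -addnA addnC => le; rewrite -IH; last by lia.
have lt : (t * b + k %% b < n.+1)%N by lia.
by have /implyP/(_ le)/eqP/esym := per_b (Ordinal lt).
Qed.

Section Decomposition.
Variables (n : nat) (f g h : boolfun n).
Hypotheses (sf : symfun f) (dec : std_decomp f g h).

(** The values of [f] on the middle third, continued with period [d] to all weights, compete with
    [g] in the minimality of [per g]. *)
Lemma per_le_mid d : (0 < d)%N ->
  (forall i, (n <= 3 * i)%N -> (3 * (i + d) <= 2 * n)%N -> Spec f i = Spec f (i + d)) ->
  (per g <= d)%N.
Proof.
move=> d0 Hd; have [_ _ min_g _] := dec.
pose lo := ((n + 2) %/ 3)%N.
(* The multiple [d * lo] leaves the residue unchanged and keeps the natural subtraction of [lo]
   exact. *)
pose f' := symfun_of n (fun i => Spec f (lo + (i + d * lo - lo) %% d)).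
have le_lo i : (lo <= i + d * lo)%N.
  by apply: leq_trans (leq_addl _ _); rewrite leq_pmull.
have per' : is_period f' d.
  rewrite /is_period d0; apply/forallP => i; apply/implyP => le.
  rewrite !Spec_symfun_of //; last by lia.
  rewrite (_ : i + d + d * lo - lo = i + d * lo - lo + d)%N ?modnDr //.
  by have := le_lo i; lia.
apply: leq_trans (per_le per'); apply: min_g; first exact: symfun_of_sym.
move=> i /andP[ge_i le_i]; rewrite Spec_symfun_of; last by lia.
have lo_i : (lo <= i)%N by rewrite /lo; lia.
have -> : (i + d * lo - lo = i - lo + lo * d)%N by have := le_lo i; lia.
rewrite (addnC (i - lo)%N) modnMDl.
have /= : (3 * (lo + (i - lo)) <= 2 * n)%N by lia.
rewrite -[in RHS](subnKC lo_i) {1 3}(divn_eq (i - lo) d).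
have lo_n : (n <= 3 * lo)%N by rewrite /lo; lia.
elim: ((i - lo) %/ d)%N => [|t IH]; first by rewrite add0n.
rewrite (mulSn t d) -addnA => le.
rewrite IH; last by lia.
by rewrite (addnCA lo d) (addnC d) -Hd //; lia.
Qed.

Section Mid.
Variable f' : boolfun n.
Hypothesis agree : agree_mid f f'.

(** Contrapositive of [per_le_mid]. Only values on the middle third enter, so [f'] can be [f] as
    well as [g]. *)
Lemma mid_separation d : (0 < d < per g)%N ->
  exists i, [/\ (n <= 3 * i)%N, (3 * (i + d) <= 2 * n)%N & Spec f' i != Spec f' (i + d)].
Proof.
case/andP=> d0 lt_d; apply: contrapT => H.
have := @per_le_mid d d0; rewrite leqNgt lt_d => /(_ _)/negP; case=> //.
move=> i le1 le2; apply: contrapT => /eqP ne; apply: H; exists i; split=> //.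
by rewrite !agree //; lia.
Qed.

Lemma mid_periodic i : (n <= 3 * i)%N -> (3 * (i + per g) <= 2 * n)%N ->
  Spec f' i = Spec f' (i + per g).
Proof.
move=> le1 le2; rewrite !agree; try lia.
have [_ ag _ _] := dec; rewrite -!ag; try lia.
by apply: (is_period_Spec (per_period g)); rewrite ?modnDr //; lia.
Qed.

End Mid.

(** A shift by more than [n / 3] leaves no pair inside the middle third, so the condition of
    [per_le_mid] is vacuous. *)
Lemma per_le_third : (per g <= n %/ 3 + 1)%N.
Proof. by apply: per_le_mid => [|i]; lia. Qed.

Lemma Spec_h i : Spec h i = Spec f i (+) Spec g i.
Proof. by have [_ _ _ ->] := dec; rewrite /Spec ffunE. Qed.

Lemma symfun_h : symfun h.
Proof.
have [sg _ _ ->] := dec => a b ab.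
by rewrite !ffunE (sf ab) (sg _ _ ab).
Qed.

Lemma h_mid i : (n <= 3 * i <= 2 * n)%N -> Spec h i = false.
Proof. by have [_ ag _ _] := dec => mid; rewrite Spec_h ag // addbb. Qed.

Lemma Bnd_le : (3 * Bnd h <= n + 2)%N.
Proof.
suff : (Bnd h <= (n + 2) %/ 3)%N by lia.
rewrite /Bnd; case: ex_minnP => m _; apply.
by apply/forallP => i; apply/forallP => j; apply/implyP => /and4P[*]; rewrite !h_mid //; lia.
Qed.

(** The constant value is read off at [n %/ 2], where [f] and [g] agree. *)
Lemma Bnd_zero i : (6 <= n)%N -> (Bnd h <= i)%N -> (i + Bnd h <= n)%N -> Spec h i = false.
Proof.
move=> n6 le1 le2; have := Bnd_le; rewrite -(@h_mid (n %/ 2)); last by lia.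
move: le1 le2; rewrite /Bnd; case: ex_minnP => m /forallP bm _ le1 le2 le3.
have lti : (i < n.+1)%N by lia.
have lt2 : (n %/ 2 < n.+1)%N by lia.
have /forallP/(_ (Ordinal lt2))/implyP/= := bm (Ordinal lti).
by move=> /(_ _)/eqP; apply; lia.
Qed.

Lemma Bnd_nonzero : (6 <= n)%N -> (0 < Bnd h)%N ->
  Spec h (Bnd h).-1 \/ Spec h (n - (Bnd h).-1).
Proof.
move=> n6 B0.
case e1: (Spec h (Bnd h).-1); first by left.
case e2: (Spec h (n - (Bnd h).-1)); first by right.
suff : (Bnd h <= (Bnd h).-1)%N by lia.
have zero i : ((Bnd h).-1 <= i)%N -> (i + (Bnd h).-1 <= n)%N -> Spec h i = false.
  move=> le1 le2; have [->//|ne1] := eqVneq i (Bnd h).-1.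
  have [->//|ne2] := eqVneq i (n - (Bnd h).-1)%N.
  by apply: Bnd_zero => //; lia.
rewrite {1}/Bnd; case: ex_minnP => m _; apply.
by apply/forallP => i; apply/forallP => j; apply/implyP => /and4P[*]; rewrite !zero.
Qed.

End Decomposition.

(** * Low degree of symmetric functions whose period is a power of the characteristic *)

(** Pascal's rule reduces to [i = 0], where p divides C(p^k, j) for 0 < j < p^k: otherwise p^k,
    which divides j C(p^k, j), would divide j. In characteristic 0 the hypotheses force [k = 0],
    hence [j = 0]. *)
Lemma bin_char_period (F : fieldType) p k i j : has_char F p -> (0 < p ^ k)%N ->
  (j < p ^ k)%N -> ('C(i + p ^ k, j)%:R : F) = 'C(i, j)%:R.
Proof.
move=> charp q0; elim: i j => [|i IH] [|j] lt_jq; rewrite ?bin0 //; last first.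
  by rewrite addSn !binS !natrD !IH //; apply: ltnW.
rewrite add0n bin0n /=; case: charp q0 lt_jq => [charp|[-> _]] q0 lt_jq; last first.
  by case: k q0 lt_jq => [|k]; rewrite ?expn0 ?exp0n.
apply/eqP; rewrite -(dvdn_pcharf charp); have p_pr := pcharf_prime charp.
apply: contraLR lt_jq; rewrite -prime_coprime // -leqNgt => cop.
apply: dvdn_leq => //; rewrite -(@Gauss_dvdl _ _ 'C(p ^ k, j.+1)) ?coprimeXl //.
by rewrite -mul_bin_diag dvdn_mulr.
Qed.

(** The matrix of the C(i, j) is triangular with unit diagonal, so the coefficients exist without
    division, in every characteristic. *)
Lemma newton_interpolation (F : fieldType) (s : nat -> F) q :
  exists c : nat -> F, forall i, (i < q)%N -> s i = \sum_(0 <= j < q) c j * 'C(i, j)%:R.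
Proof.
elim: q => [|q [c Hc]]; first by exists s.
pose c' j := if j == q then s q - \sum_(0 <= j < q) c j * 'C(q, j)%:R else c j.
have E i : \sum_(0 <= j < q) c' j * 'C(i, j)%:R = \sum_(0 <= j < q) c j * 'C(i, j)%:R.
  by apply: eq_big_nat => j /andP[_ lt]; rewrite /c' (ltn_eqF lt).
exists c' => i; rewrite ltnS leq_eqVlt big_nat_recr //= E => /orP[/eqP->|lt].
  by rewrite /c' eqxx binn mulr1 addrC subrK.
by rewrite bin_small // mulr0 addr0 Hc.
Qed.

Lemma elementary_symmetricE (F : fieldType) n j (a : cube n) :
  \sum_(S : {set 'I_n} | #|S| == j) \prod_(i in S) (a i)%:R = 'C(weight a, j)%:R :> F.
Proof.
rewrite /weight -cards_draws -sum1_card natr_sum big_mkcond [RHS]big_mkcond /=.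
apply: eq_bigr => S _; rewrite inE andbC; case: (#|S| == j) => //=.
case: ifP => [/fintype.subsetP sub|/negbT/subsetPn[i iS]].
  by rewrite big1 // => i /sub; rewrite inE => ->.
by rewrite inE => /negPf ai; rewrite (bigD1 i) //= ai mul0r.
Qed.

(** On one period [Spec g] is a combination of the C(i, j) with j < p^k. These are p^k-periodic in
    [F], and at the weight of [a] they are elementary symmetric polynomials of degree j in the
    coordinates. *)
Lemma lowdeg_period (F : fieldType) n p k (g : boolfun n) : has_char F p ->
  symfun g -> is_period g (p ^ k) -> lowdeg (p ^ k).-1 (fun a => (g a)%:R : F).
Proof.
move=> charp sg per_q; have /andP[q0 _] := per_q.
have [c Hc] := newton_interpolation (fun i => (Spec g i)%:R : F) (p ^ k).
have binE i j : (j < p ^ k)%N -> ('C(i, j)%:R : F) = 'C(i %% p ^ k, j)%:R.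
  move=> lt; rewrite {1}(divn_eq i (p ^ k)) addnC.
  elim: (i %/ _)%N => [|t IH]; first by rewrite addn0.
  by rewrite mulSnr addnA (bin_char_period _ charp).
have wle (a : cube n) : (weight a <= n)%N by rewrite -[leqRHS]card_ord max_card.
have E : (fun a => (g a)%:R : F) =1 (fun a => \sum_(0 <= j < p ^ k) c j *
    \sum_(S : {set 'I_n} | #|S| == j) \prod_(i in S) (a i)%:R).
  move=> a; under eq_big_nat => j /andP[_ lt].
    by rewrite elementary_symmetricE binE //; over.
  rewrite -Hc ?ltn_mod // (SpecE _ sg).
  rewrite (is_period_Spec per_q (wle a) _ (esym (modn_mod _ _))) //.
  exact: leq_trans (leq_mod _ _) (wle a).
move=> m rho Hrho; apply: (@eq_degle _ _ _ (fun y => \sum_(0 <= j < p ^ k | (j < p ^ k)%N)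
    c j * \sum_(S : {set 'I_n} | #|S| == j) \prod_(i in S) (rho y i)%:R)) => [y|].
  by rewrite E [RHS]big_nat_cond big_nat_cond; apply: eq_bigl => j; case: (j < _)%N; rewrite ?andbT ?andbF.
apply: degle_sum => j lt_j; apply: degleZ; apply: degle_sum => S /eqP cardS.
apply: (@degle_mono _ _ (\sum_(i in S) 1)); first by rewrite sum1_card cardS; lia.
exact: degle_prod.
Qed.

(** * From tests to an upper bound on a binomial coefficient *)

Lemma card_hcube m : #|hcube m| = (2 ^ m)%N.
Proof. by elim: m => [|m IH] /=; rewrite ?card_unit // card_prod card_bool IH expnS. Qed.

Definition passes n (f : boolfun n) (T : seq nat) (k i : nat) : bool :=
  all (fun s => Spec f (i + s) == Spec f (k + s)) T.

Section Tests.
Variables (R : realType) (F : fieldType) (n : nat) (f : boolfun n).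
Hypothesis sf : symfun f.

Lemma test_polynomial d (err : R) T m k : approx F d err f ->
  (forall s, s \in T -> (m + s <= n)%N) ->
  exists (P : hcube m -> F) (S : {set hcube m}),
  [/\ degle (size T * d) P, #|S|%:R <= (size T)%:R * err * 2 ^+ m &
      forall y, y \notin S -> P y = (passes f T k (wt y))%:R].
Proof.
move=> /(approx_derandomize T (fun s (y : hcube m) => shift n s y))[phi dphi].
set S := [set y | _] => cardS Tn.
exists (fun y => \prod_(s <- T) literal (Spec f (k + s)) (phi (shift n s y))), S; split.
- apply: (@degle_mono _ _ (\sum_(s <- T) d)).
    by rewrite big_const_seq count_predT iter_addn_0 mulnC.
  apply: degle_prod => s _; apply/degle_literal/dphi => j.
  exact: degle_shift.
- by rewrite card_hcube natrX in cardS.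
move=> y; rewrite inE -all_predC => /allP yS; rewrite /passes.
elim: T Tn yS {S cardS} => [|s T IH] Tn yS; first by rewrite big_nil.
rewrite big_cons IH /= => [|t tT|t tT]; last 2 first.
- by apply: Tn; rewrite inE tT orbT.
- by apply: yS; rewrite inE tT orbT.
have := yS s (mem_head _ _); rewrite /= negbK => /eqP->.
rewrite (Spec_shift y sf) ?Tn ?mem_head // literal_bool eq_sym.
by case: (_ == _); rewrite ?mul1r ?mul0r.
Qed.

(** [S0] collects points exempt from one-sided rejection, such as those beyond a window; it is
    merged with the error set of the test polynomial. *)
Lemma binomial_le d (err : R) T k (S0 : {set hcube (k + k)}) : approx F d err f ->
  (forall s, s \in T -> (k + k + s <= n)%N) -> (size T * d < k)%N ->
  [\/ forall y, y \notin S0 -> (k < wt y)%N -> ~~ passes f T k (wt y),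
      forall y, y \notin S0 -> (wt y < k)%N -> ~~ passes f T k (wt y) |
      exists q, [/\ prime q, (q%:R : F) != 0 &
        forall i, (i <= k + k)%N -> passes f T k i -> i = k %[mod q]]] ->
  ('C(k + k, k - (size T * d).+1))%:R <= #|S0|%:R + (size T)%:R * err * 2 ^+ (k + k).
Proof.
move=> /test_polynomial ap /ap{ap} /(_ k)[P [S [dP cardS PS]]] lt_k side.
rewrite leNgt; apply/negP => lt_bin.
(* The largest [D] with [size T * d + D < k]: each of the three degree bounds is then
   contradictory. *)
set D := (k - _)%N in lt_bin.
have ltS : (#|S0 :|: S| < 'C(k + k, D))%N.
  rewrite -(ltr_nat R); apply: le_lt_trans lt_bin.
  apply: le_trans (_ : #|S0|%:R + #|S|%:R <= _); last by rewrite lerD2l.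
  by rewrite -natrD ler_nat cardsU leq_subr.
have leDk : (D <= k)%N by rewrite /D leq_subr.
have leDkk : (k + D <= k + k)%N by rewrite leq_add2l.
have Pk y : y \notin S0 :|: S -> wt y = k -> P y != 0.
  rewrite inE negb_or => /andP[_ /PS->] ->.
  by rewrite /passes (eq_all (a2 := predT)) ?all_predT ?oner_neq0 // => s; rewrite eqxx.
suff : (k <= size T * d + D)%N by rewrite /D; lia.
have fails y : ~~ passes f T k (wt y) -> y \notin S -> P y = 0.
  by move=> /negPf Hf /PS->; rewrite Hf.
case: side => [H|H|[q [q_pr q0 H]]].
- rewrite -[leqLHS](addnK k); apply: (degree_ge_above leDk leDkk ltS dP Pk) => y.
  by rewrite inE negb_or => /andP[y0 yS] /(H _ y0) /fails; apply.
- apply: (degree_ge_below leDk leDkk ltS dP Pk) => y.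
  by rewrite inE negb_or => /andP[y0 yS] /(H _ y0) /fails; apply.
have := degree_ge_residue q_pr q0 leDk leDkk ltS dP Pk.
suff: forall y, y \notin S0 :|: S -> wt y != k %[mod q] -> P y = 0.
  by move=> H0 /(_ H0); lia.
move=> y; rewrite inE negb_or => /andP[y0 yS] ne; apply: fails yS.
by apply: contra ne => /(H _ (wt_le y))->.
Qed.

(* With fewer than one expected error, some polynomial makes no error at all. *)
Lemma and_type_degree d (err : R) m s b : approx F d err f ->
  (m + s <= n)%N -> err * 2 ^+ m < 1 ->
  (forall i, (i <= m)%N -> Spec f (i + s) = (i == if b then m else 0%N)) ->
  (m <= d)%N.
Proof.
move=> ap le_n lt1 Hs; pose k := if b then m else 0%N.
have [|P [S [dP cardS PS]]] := @test_polynomial d err [:: s] m k ap.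
  by move=> t; rewrite inE => /eqP->.
have S0 : #|S| = 0%N.
  apply/eqP; rewrite -leqn0 -ltnS -(ltr_nat R); apply: le_lt_trans cardS _.
  by rewrite mul1r.
have ltS : (#|S| < 'C(m, 0))%N by rewrite S0 bin0.
have lekm : (k <= m)%N by rewrite /k; case: (b).
have E y : y \notin S -> P y = (wt y == k)%:R.
  move=> /PS->; rewrite /passes /= andbT !Hs ?wt_le //.
  by rewrite -/k eqxx eqb_id.
have Pk y : y \notin S -> wt y = k -> P y != 0.
  by move=> /E-> ->; rewrite eqxx oner_neq0.
rewrite /= mul1n in dP.
have lek0 : (k + 0 <= m)%N by rewrite addn0.
have [km|k0] : k = m \/ k = 0%N by rewrite /k; case: (b); [left|right].
  have := degree_ge_below (leq0n k) lek0 ltS dP Pk; rewrite addn0 km; apply.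
  by move=> y /E-> lt; rewrite km ltn_eqF.
have := degree_ge_above (leq0n k) lek0 ltS dP Pk; rewrite addn0 k0 subn0; apply.
by move=> y /E-> lt; rewrite k0 gtn_eqF.
Qed.

End Tests.

(** * Logarithmically many tests from the minimality of the period *)

Section FindTests.
Variables (n : nat) (f g h f' : boolfun n).
Hypotheses (dec : std_decomp f g h) (agree : agree_mid f f').

(* The isolated weight need not be the centre of the window [0, 2w]; moving it to
   [k] leaves [w] rejected layers on one of the two sides. *)
Lemma window_tests k w : (2 * w < per g)%N -> (3 * (2 * w + k) <= n)%N ->
  exists T : seq nat, [/\ (2 ^ size T <= 2 * w + 1)%N,
    forall s, s \in T -> (k + k + s <= n)%N &
    (forall i, (k < i <= k + w)%N -> ~~ passes f' T k i) \/
    (forall i, (k <= i + w)%N -> (i < k)%N -> ~~ passes f' T k i)].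
Proof.
move=> lt_b le_n.
pose sigma s (c : 'I_(2 * w).+1) := Spec f' (s + c).
pose V s := (k <= s)%N /\ (s + 2 * w + k <= n)%N.
have sep_lt (c c' : 'I_(2 * w).+1) : (c < c')%N -> exists2 s, V s & sigma s c != sigma s c'.
  move=> lt; have ltc := ltn_ord c; have ltc' := ltn_ord c'.
  have [|i [le1 le2 ne]] := mid_separation dec agree (d := c' - c).
    by rewrite subn_gt0 lt /=; lia.
  exists (i - c)%N; first by split; lia.
  rewrite /sigma (_ : i - c + c = i)%N; last by lia.
  by rewrite (_ : i - c + c' = i + (c' - c))%N //; lia.
have [|c c' _ _ ne|S [c0 [_ sizeS VS uniqS]]] := splitting_tests (sigma := sigma) (V := V) (C := [set: 'I_(2 * w).+1]).
- by apply/set0Pn; exists ord0.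
- have [lt|gt|e] := ltngtP c c'; first exact: sep_lt.
    by have [s Vs ne'] := sep_lt _ _ gt; exists s; rewrite // eq_sym.
  by rewrite (val_inj e) eqxx in ne.
have ltc0 := ltn_ord c0.
(* The translation sends the surviving candidate [c0] to the weight [k]; the bound [k <= s] in [V]
   keeps the subtraction exact. *)
exists [seq (s + c0 - k)%N | s <- S]; split.
- by rewrite size_map; apply: leq_trans sizeS _; rewrite cardsT card_ord; lia.
- by move=> _ /mapP[s /VS[le1 le2] ->]; lia.
have pass_eq i : (k <= i + c0)%N -> (i + c0 <= k + 2 * w)%N ->
    passes f' [seq (s + c0 - k)%N | s <- S] k i -> i = k.
  move=> le1 le2; rewrite /passes all_map => /allP Hs.
  have ltc : (i + c0 - k < (2 * w).+1)%N by lia.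
  have := uniqS (Ordinal ltc) (in_setT _); move=> /(_ _)/(congr1 val) /=.
  move=> H; suff: (i + c0 - k)%N = c0 by lia.
  apply: H => s sS; have [V1 V2] := VS s sS.
  have := Hs s sS; rewrite /= /sigma /= => /eqP.
  rewrite (_ : i + (s + c0 - k) = s + (i + c0 - k))%N; last by lia.
  by rewrite (_ : k + (s + c0 - k) = s + c0)%N; last by lia.
case: (leqP c0 w) => le_c0; [left => i /andP[lt le]|right => i le lt].
  by apply/negP => /pass_eq; lia.
by apply/negP => /pass_eq; lia.
Qed.

(** The candidates are the residues modulo [per g], any two of which differ under some shift.
    Reducing the shifts modulo the period keeps all probed weights in the middle third. *)
Lemma residue_tests k : (3 * per g + 6 * k + 2 <= n)%N ->
  exists T : seq nat, [/\ (2 ^ size T <= per g)%N,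
    forall s, s \in T -> (k + k + s <= n)%N &
    forall i, (i <= k + k)%N -> passes f' T k i -> i = k %[mod per g]].
Proof.
set b := per g => le_n; have b0 : (0 < b)%N := per_gt0 g.
pose lo := ((n + 2) %/ 3)%N.
have lo_n : (n <= 3 * lo)%N by rewrite /lo; lia.
have lo_n2 : (3 * lo <= n + 2)%N by rewrite /lo; lia.
(* The periodic continuation of the middle values lets shifts be chosen freely before they are
   reduced. *)
pose tau z := Spec f' (lo + z %% b).
have tauE z : (3 * (lo + z) <= 2 * n)%N -> Spec f' (lo + z) = tau z.
  rewrite /tau {1 2}(divn_eq z b).
  elim: (z %/ b)%N => [|t IH]; first by rewrite add0n.
  rewrite (mulSn t b) -addnA => le; rewrite -IH; last by lia.
  by rewrite (addnCA lo b) (addnC b) -(mid_periodic dec agree) //; lia.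
have tau_mod z z' : z = z' %[mod b] -> tau z = tau z' by rewrite /tau => ->.
pose sigma s (c : 'I_b) := tau (s + c)%N.
have sep_lt (c c' : 'I_b) : (c < c')%N -> exists2 s, True & sigma s c != sigma s c'.
  move=> lt; have ltc := ltn_ord c; have ltc' := ltn_ord c'.
  have [|i [le1 le2 ne]] := mid_separation dec agree (d := c' - c).
    by rewrite subn_gt0 lt /=; lia.
  have lo_i : (lo <= i)%N by rewrite /lo; lia.
  (* Modulo [b] the term [c * b.-1] is the negative of [c]. *)
  exists (i - lo + c * b.-1)%N => //.
  have cb : (c * b.-1 + c = c * b)%N by rewrite -mulnSr prednK.
  have -> : sigma (i - lo + c * b.-1)%N c = Spec f' i.
    rewrite -[in RHS](subnKC lo_i) tauE; last by lia.
    by apply: tau_mod; rewrite -addnA cb addnC modnMDl.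
  have -> // : sigma (i - lo + c * b.-1)%N c' = Spec f' (i + (c' - c)).
  rewrite (_ : i + (c' - c) = lo + (i - lo + (c' - c)))%N; last by lia.
  rewrite tauE; last by lia.
  apply: tau_mod.
  rewrite (_ : i - lo + c * b.-1 + c' = (c * b) + (i - lo + (c' - c)))%N; last by lia.
  by rewrite modnMDl.
have [|c c' _ _ ne|S [c0 [_ sizeS _ uniqS]]] := splitting_tests (sigma := sigma) (V := fun=> True) (C := [set: 'I_b]).
- by apply/set0Pn; exists (Ordinal b0).
- have [lt|gt|e] := ltngtP c c'; first exact: sep_lt.
    by have [s Vs ne'] := sep_lt _ _ gt; exists s; rewrite // eq_sym.
  by rewrite (val_inj e) eqxx in ne.
(* Again [k * b.-1] stands for the negative of [k]: the shifted test takes the weight [k] to the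
   candidate [c0]. *)
pose sh s := ((s + c0 + k * b.-1) %% b)%N.
have sh_b s : (sh s < b)%N by rewrite ltn_mod.
exists [seq (lo + sh s)%N | s <- S]; split.
- by rewrite size_map; apply: leq_trans sizeS _; rewrite cardsT card_ord.
- by move=> _ /mapP[s _ ->]; have := sh_b s; lia.
have kb : (k + k * b.-1 = k * b)%N by rewrite -mulnS prednK.
move=> i le_i; rewrite /passes all_map => /allP Hs.
pose c := Ordinal (ltn_pmod (c0 + k * b.-1 + i) b0).
have c_eq : c = c0.
  apply: uniqS; first exact: in_setT.
  move=> s sS; have /eqP := Hs s sS; rewrite /= !(addnCA _ lo) !tauE; last 2 first.
  - by have := sh_b s; lia.
  - by have := sh_b s; lia.
  rewrite /sigma /= => e.
  transitivity (tau (i + sh s)).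
    by apply: tau_mod; rewrite /sh modnDmr [RHS]modnDmr; congr modn; lia.
  rewrite e; apply: tau_mod; rewrite /sh modnDmr (_ : k + _ = k * b + (s + c0))%N; last by lia.
  by rewrite modnMDl.
have := congr1 val c_eq; rewrite /= => e0.
have e1 : (c0 + k * b.-1 + i + k = c0 + k %[mod b])%N.
  by rewrite -modnDml e0.
have e2 : (c0 + k * b.-1 + i + k = c0 + i %[mod b])%N.
  by rewrite (_ : _ + k = k * b + (c0 + i))%N ?modnMDl //; lia.
by apply/eqP; rewrite -(eqn_modDl c0) -e1 e2.
Qed.

End FindTests.

(** * Estimates of binomial coefficients and tails *)

Lemma central_bin_ge k : (2 ^ (k + k) <= (k + k).+1 * 'C(k + k, k))%N.
Proof.
elim: k => [//|k IH].
have e1 := mul_bin_diag (k.+1 + k.+1) k.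
have e2 := mul_bin_down (k + k).+1 k.
have e : ((k.+1 + k.+1).-1 = (k + k).+1)%N by lia.
rewrite e in e1; rewrite /= in e2.
have e' : ((k + k).+1 - k = k.+1)%N by lia.
rewrite e' in e2; set a := 'C(k + k, k) in IH e2; set b := 'C(_.+1, k) in e1 e2.
set c := 'C(_, k.+1) in e1 *.
have cb : (c = 2 * b)%N by nia.
have -> : (2 ^ (k.+1 + k.+1) = 4 * 2 ^ (k + k))%N by rewrite addSn addnS !expnS mulnA.
have : ((k + k).+1 * a <= (k + k).+1 * a)%N by [].
nia.
Qed.

Section Numerics.
Variable R : realType.
Implicit Types (x : R).

(** Stepping from [j] to [j + 1] divides the coefficient by (k + j + 1) / (k - j), at most exp(2 (2
    j + 1) / k) in this range; the odd numbers 2 j + 1 add up to a square. *)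
Lemma bin_offset_ge k j : (2 * j <= k)%N -> (0 < k)%N ->
  ('C(k + k, k))%:R * expR (- (2 * (j%:R : R) ^+ 2 / k%:R)) <= ('C(k + k, k - j))%:R.
Proof.
move=> le_jk k0; have k0R : (0 : R) < k%:R by rewrite ltr0n.
elim: j le_jk => [|j IH] le_jk.
  by rewrite mulr0n expr0n /= mulr0 mul0r oppr0 expR0 mulr1 subn0.
have /IH {}IH : (2 * j <= k)%N by lia.
have e := mul_bin_left (k + k) (k - j.+1).
have e1 : ((k - j.+1).+1 = k - j)%N by lia.
have e2 : (k + k - (k - j.+1) = k + j.+1)%N by lia.
rewrite e1 e2 in e.
set a := 'C(k + k, k - j) in IH e; set b := 'C(k + k, k - j.+1) in e *.
clearbody a b.
have eR : (k%:R - j%:R) * a%:R = (k%:R + j%:R + 1) * b%:R :> R.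
  have := congr1 (GRing.natmul (1 : R)) e.
  rewrite !natrM natrB; last by lia.
  by rewrite natrD -addn1 natrD addrA.
pose z : R := 2 * (2 * j%:R + 1) / k%:R.
have split_exp : - (2 * j.+1%:R ^+ 2 / k%:R) = - (2 * j%:R ^+ 2 / k%:R) - z :> R.
  by rewrite /z -addn1 natrD; field; rewrite gt_eqF.
have jk : (2 * j%:R + 2 <= k%:R :> R) by rewrite -natrM -natrD ler_nat; lia.
have j0 : (0 : R) <= j%:R by [].
have z_k : z * k%:R = 2 * (2 * j%:R + 1) by rewrite /z mulrVK // unitfE gt_eqF.
have ratio : (k%:R + j%:R + 1 : R) <= (k%:R - j%:R) * expR z.
  have : 1 + z <= expR z := expR_ge1Dx z.
  have z0 : 0 <= z by rewrite /z divr_ge0 // ltW //; lra.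
  set E := expR z => zE.
  have : 0 <= (k%:R - j%:R) * (E - (1 + z)) by apply: mulr_ge0; lra.
  have : 0 <= z * (k%:R - 2 * j%:R) by apply: mulr_ge0; lra.
  lra.
have b0 : (0 : R) <= b%:R by [].
have ab : a%:R <= expR z * b%:R :> R.
  rewrite -(ler_pM2l (_ : 0 < k%:R - j%:R)); last by lra.
  by rewrite eR mulrA ler_wpM2r.
rewrite split_exp expRD mulrA (expRN z) ler_pdivrMr ?expR_gt0 //.
by apply: le_trans IH _; rewrite mulrC.
Qed.

Lemma sum_wt m (a b : R) : \sum_(y : hcube m) a ^+ wt y * b ^+ (m - wt y) = (a + b) ^+ m.
Proof.
elim: m => [|m IH] /=.
  by rewrite (bigD1 tt) //= big1 ?addr0 ?mulr1 // => -[].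
rewrite -(pair_bigA _ (fun (u : bool) (y : hcube m) => a ^+ (u + wt y) * b ^+ (m.+1 - (u + wt y)))) /=.
rewrite big_bool /= exprS -IH mulrDl !mulr_sumr; congr (_ + _); apply: eq_bigr => y _.
  by rewrite add1n subSS exprS mulrA.
by rewrite add0n subSn ?wt_le // exprS mulrCA.
Qed.

(* Markov's inequality for [(1 + w/k) ^ weight]. *)
Lemma tail_bound k w (A : {set hcube (k + k)}) : (0 < k)%N -> (w <= k)%N ->
  (forall y, y \in A -> (k + w <= wt y)%N) \/ (forall y, y \in A -> (wt y + w <= k)%N) ->
  #|A|%:R <= 2 ^+ (k + k) * expR (- (w%:R ^+ 2 / (4 * k%:R))) :> R.
Proof.
move=> k0 wk HA; have k0R : (0 : R) < k%:R by rewrite ltr0n.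
pose x : R := w%:R / k%:R.
have x0 : 0 <= x by rewrite divr_ge0.
have x1 : x <= 1 by rewrite ler_pdivrMr // mul1r ler_nat.
have moment : #|A|%:R * (1 + x) ^+ (k + w) <= (2 + x) ^+ (k + k).
  have x1' : 1 <= 1 + x by lra.
  case: HA => HA.
    have -> : 2 + x = (1 + x) + 1 by lra.
    rewrite -(sum_wt _ (1 + x) 1) mulr_natl -sumr_const big_mkcond; apply: ler_sum => y _.
    rewrite expr1n mulr1; case: ifP => [/HA le|_]; last by rewrite exprn_ge0 //; lra.
    exact: ler_weXn2l.
  have -> : 2 + x = 1 + (1 + x) by lra.
  rewrite -(sum_wt _ 1 (1 + x)) mulr_natl -sumr_const big_mkcond; apply: ler_sum => y _.
  rewrite expr1n mul1r; case: ifP => [/HA le|_]; last by rewrite exprn_ge0 //; lra.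
  by apply: ler_weXn2l => //; lia.
(* Indeed (2 + x)^2 = 4 (1 + x) + x^2 is at most 4 (1 + x) (1 + x^2 / 4). *)
have sq : (2 + x) ^+ 2 <= 2 ^+ 2 * ((1 + x) * expR (x ^+ 2 / 4)).
  have : 1 + x ^+ 2 / 4 <= expR (x ^+ 2 / 4) := expR_ge1Dx _.
  by set E := expR _; nra.
have upper : (2 + x) ^+ (k + k) <= 2 ^+ (k + k) * ((1 + x) ^+ k * expR (k%:R * (x ^+ 2 / 4))).
  rewrite addnn -mul2n !exprM expRM_natl -exprMn -exprMn.
  apply: lerXn2r sq; rewrite nnegrE; first by rewrite exprn_ge0 //; lra.
  by rewrite !mulr_ge0 ?expR_ge0 //; lra.
(* For 0 <= x <= 1 one has (1 + x) (1 - x / 2) >= 1, hence 1 + x >= exp(x / 2). *)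
have lower : expR (w%:R * (x / 2)) <= (1 + x) ^+ w.
  rewrite expRM_natl; apply: lerXn2r; rewrite ?nnegrE ?expR_ge0 //; first by lra.
  have : 1 + - (x / 2) <= expR (- (x / 2)) := expR_ge1Dx _.
  rewrite expRN; have : 0 < expR (x / 2) by apply: expR_gt0.
  set E := expR _ => E0; rewrite -[E^-1]div1r ler_pdivlMr // => H.
  have H1 : 0 <= x * (1 - x) * E.
    by apply: mulr_ge0; [apply: mulr_ge0; lra|exact: ltW].
  have H2 : 0 <= (1 + x) * (1 - (1 + - (x / 2)) * E) by apply: mulr_ge0; lra.
  lra.
have p0 : 0 < (1 + x) ^+ k by rewrite exprn_gt0 //; lra.
have main : #|A|%:R * expR (w%:R * (x / 2)) <= 2 ^+ (k + k) * expR (k%:R * (x ^+ 2 / 4)).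
  rewrite -(ler_pM2r p0); apply: le_trans (_ : #|A|%:R * (1 + x) ^+ (k + w) <= _).
    by rewrite exprD -mulrA ler_wpM2l // mulrC ler_wpM2l // ltW.
  apply: le_trans moment (le_trans upper _).
  by rewrite -!mulrA [X in _ * X]mulrC.
have -> : - (w%:R ^+ 2 / (4 * k%:R)) = k%:R * (x ^+ 2 / 4) - w%:R * (x / 2).
  by rewrite /x; field; rewrite gt_eqF.
by rewrite expRD expRN mulrA ler_pdivlMr ?expR_gt0.
Qed.

(** The lower bound 4^k exp(-2 j^2 / k) / (2 k + 1) meets the assumed upper bound. The polynomial
    factors are at most n^2 <= exp(Lam / 2), so half of [Lam] remains in the exponent. *)
Lemma degree_from_binomial n k j (Lam : R) : (0 < k)%N -> (k + k + 2 <= n)%N ->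
  Lam <= 2 * k%:R -> 4 * ln n%:R <= Lam ->
  ((j <= k)%N -> ('C(k + k, k - j))%:R <= 2 ^+ (k + k) * (n.+1%:R * expR (- Lam))) ->
  k%:R * Lam <= 8 * j%:R ^+ 2.
Proof.
move=> k0 kn; have nat_le : ((k + k).+1 * n.+1 <= n ^ 2)%N by nia.
move=> Lk Ln Hbin; have k0R : (0 : R) < k%:R by rewrite ltr0n.
have j0 : (0 : R) <= j%:R by [].
(* For [k < 2 * j] the claim follows from [Lam <= 2 * k%:R] alone; this case fixes the constant
   8. *)
have [le_jk|gt_jk] := leqP (2 * j) k; last first.
  have : (k%:R : R) <= 2 * j%:R by rewrite -natrM ler_nat ltnW.
  by nra.
have n0 : (0 : R) < n%:R by rewrite ltr0n; lia.
have /Hbin {}Hbin : (j <= k)%N by lia.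
have cen : 2 ^+ (k + k) <= (k + k).+1%:R * ('C(k + k, k))%:R :> R.
  by rewrite -natrX -natrM ler_nat central_bin_ge.
have off := bin_offset_ge le_jk k0.
set e1 := expR (- (2 * _ / _)) in off.
have e1_0 : 0 < e1 by apply: expR_gt0.
have P0 : 0 < 2 ^+ (k + k) :> R by apply: exprn_gt0.
have le1 : e1 <= (k + k).+1%:R * n.+1%:R * expR (- Lam).
  rewrite -(ler_pM2l P0); apply: le_trans (ler_wpM2r (ltW e1_0) cen) _.
  rewrite -[leLHS]mulrA; apply: le_trans (ler_wpM2l (ler0n _ _) (le_trans off Hbin)) _.
  by rewrite mulrCA -!mulrA.
have le2 : ((k + k).+1%:R * n.+1%:R : R) <= n%:R ^+ 2.
  by rewrite -natrM -natrX ler_nat.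
have le3 : n%:R ^+ 2 <= expR (Lam / 2).
  rewrite -[n%:R in X in X <= _]lnK ?posrE // -expRM_natl ler_expR.
  by lra.
have : e1 <= expR (- (Lam / 2)).
  apply: le_trans le1 _; apply: le_trans (ler_wpM2r (expR_ge0 _) (le_trans le2 le3)) _.
  by rewrite -expRD ler_expR; lra.
rewrite /e1 ler_expR lerN2 ler_pdivlMr // => H.
by nra.
Qed.

End Numerics.

(** * Xor with a low-degree function, prime divisors and window sizes *)

Lemma approx_le (R : realType) (F : fieldType) n d (e1 e2 : R) (f : boolfun n) :
  e1 <= e2 -> approx F d e1 f -> approx F d e2 f.
Proof.
move=> le12 [I [w [phi [w0 w1 dphi ephi]]]].
by exists I, w, phi; split=> // a; apply: le_trans (ephi a) le12.
Qed.

(** On bits, xor is a (1 - 2 b) + b, which adds the degrees and is correct wherever the polynomial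
    for [f] is. *)
Lemma approx_addb (R : realType) (F : fieldType) n d e' (eps : R) (f g h : boolfun n) :
  approx F d eps f -> lowdeg e' (fun a => (g a)%:R : F) -> (forall a, h a = f a (+) g a) ->
  approx F (d + e') eps h.
Proof.
case=> I [w [phi [w0 w1 dphi ephi]]] dg hE.
exists I, w, (fun i a => phi i a * (1 - 2 * (g a)%:R) + (g a)%:R); split=> //.
  move=> i m rho Hrho; apply: degleD.
    apply: degleM; first exact: dphi.
    by apply: degleB (degle_cst _ _ _) (degleZ _ _); apply: dg.
  by apply: degle_mono (leq_addl _ _) _; apply: dg.
move=> a; apply: le_trans (ephi a); rewrite big_mkcond [leRHS]big_mkcond /=.
apply: ler_sum => i _; have [e|_] := eqVneq (phi i a) (f a)%:R; last by case: ifP => _ /=; rewrite ?lexx ?w0.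
rewrite e hE; case: (f a) (g a) => -[] /=; rewrite ?(mulr0, mulr1, mul0r, mul1r, subr0, addr0, add0r) ?eqxx //.
by rewrite (_ : 1 - 2 + 1 = 0 :> F) ?eqxx //; ring.
Qed.

Lemma nonpower_prime_divisor (F : fieldType) p b : has_char F p -> (1 < b)%N ->
  ~ power_of p b -> exists q, [/\ prime q, (q%:R : F) != 0 & (q %| b)%N].
Proof.
move=> charp b1 npow; have b0 : (0 < b)%N by lia.
have [charp'|[_ char0]] := charp; last first.
  exists (pdiv b); split; rewrite ?pdiv_prime ?pdiv_dvd //.
  have := char0 (pdiv b); rewrite inE pdiv_prime //= => ->//.
have p_pr := pcharf_prime charp'.
have [q [q_pr qb qp]] : exists q, [/\ prime q, (q %| b)%N & q != p].
  apply: contrapT => H; apply: npow.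
  suff /p_natP[k e] : p.-nat b by exists k.
  apply/pnatP => // q q_pr qb; apply: contrapT => /negP qp; apply: H.
  by exists q; split=> //; move: qp; rewrite inE.
exists q; split=> //; apply: contraNneq qp => q0.
have : q \in [pchar F] by rewrite inE q_pr q0 /=.
by rewrite (pcharf_eq charp').
Qed.

Lemma ln2_bounds (R : realType) : (1 / 2 : R) <= ln (2 : R) <= 1.
Proof.
have H1 : 1 + 1 <= expR (1 : R) := expR_ge1Dx _.
have : 1 + - (1 / 2) <= expR (- (1 / 2) : R) := expR_ge1Dx _.
rewrite expRN -[(expR _)^-1]div1r ler_pdivlMr ?expR_gt0 // => H2.
by apply/andP; split; rewrite -ler_expR lnK ?posrE ?ltr0n //; lra.
Qed.

(* [k] is chosen of order [min(n, b^2/M)] and [w] of order [min(b, k)]. *)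
Lemma window_parameters (R : realType) (n b : nat) (M : R) :
  400 <= M -> M <= b%:R -> (b <= n %/ 3 + 1)%N -> exists k w : nat,
  [/\ (0 < k)%N, (w <= k)%N, (5 * w <= b)%N, (10 * k <= n)%N &
      [/\ M / 25 <= k%:R, k%:R * M / 25 <= w%:R ^+ 2 &
        (n%:R : R) <= 20 * k%:R \/ (b%:R : R) ^+ 2 <= 4 * (k%:R * M)]].
Proof.
move=> M_ge M_b b_n.
have bR : 3 * b%:R <= n%:R + 3 :> R by rewrite -natrM -natrD ler_nat; clear - b_n; lia.
have M0 : 0 < M by lra.
pose q := b%:R ^+ 2 / (2 * M).
have qM : q * M = b%:R ^+ 2 / 2 by rewrite /q; field; rewrite gt_eqF.
have bb : M * b%:R <= b%:R ^+ 2 by rewrite expr2 ler_wpM2r.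
have MM : M * M <= M * b%:R by rewrite ler_wpM2l // ltW.
have q_ge : M / 2 <= q by rewrite -(ler_pM2r M0) qM; lra.
have /andP[] : (Num.truncn q)%:R <= q < (Num.truncn q).+1%:R by apply: truncn_itv; lra.
set k2 := Num.truncn q => k2_le; rewrite -natr1 => k2_gt.
pose k1 := (n %/ 10)%N.
have k1_ge : n%:R <= 10 * k1%:R + 10 :> R by rewrite -natrM -natrD ler_nat /k1; clear - n; lia.
pose w1 := (b %/ 5)%N.
have w1_ge : b%:R <= 5 * w1%:R + 5 :> R by rewrite -natrM -natrD ler_nat /w1; clear - b; lia.
have k1_n : (10 * k1 <= n)%N by rewrite /k1; clear - n; lia.
have w1_b : (5 * w1 <= b)%N by rewrite /w1; clear - b; lia.
clearbody q k1 k2 w1.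
have [k [k_k1 k_M k_q k_or]] : exists k, [/\ (k <= k1)%N, M / 25 <= k%:R, k%:R <= q &
    (n%:R : R) <= 20 * k%:R \/ (b%:R : R) ^+ 2 <= 4 * (k%:R * M)].
  case: (leP (k1%:R : R) k2%:R) => k12.
    by exists k1; split; [by []|lra|lra|left; lra].
  exists k2; split; [by rewrite -(ler_nat R) ltW|lra|by []|right].
  have : (q - 1) * M <= k2%:R * M by apply: ler_wpM2r; lra.
  have : 4 * M <= M * b%:R by rewrite mulrC ler_wpM2l; lra.
  by rewrite mulrBl qM; lra.
have k0 : (0 < k)%N by rewrite -(ltr_nat R); lra.
have kM : k%:R * M <= b%:R ^+ 2 / 2 by rewrite -qM; apply: ler_wpM2r => //; lra.
have [w [wk wb w2]] : exists w, [/\ (w <= k)%N, (5 * w <= b)%N & k%:R * M / 25 <= (w%:R : R) ^+ 2].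
  have [w1k|kw1] := leqP w1 k; [exists w1|exists k]; split=> //.
    have b6 : b%:R / 6 <= w1%:R :> R by lra.
    have : (b%:R / 6) ^+ 2 <= w1%:R ^+ 2 :> R by apply: lerXn2r; rewrite ?nnegrE //; lra.
    have -> : (b%:R / 6) ^+ 2 = b%:R ^+ 2 / 36 :> R by field.
    by have := sqr_ge0 (b%:R : R); lra.
    by apply: leq_trans w1_b; rewrite leq_mul2l ltnW // orbT.
  have : k%:R * (M / 25) <= k%:R * k%:R by apply: ler_wpM2l.
  by rewrite -expr2; lra.
exists k, w; split=> //.
by clear - k_k1 k1_n; lia.
Qed.

(** * Degree bounds coming from the period *)

Section Bounds.
Variables (R : realType) (F : fieldType) (n : nat) (eps L : R).
Notation ell := (ln n%:R : R).
Hypotheses (ell_ge : 100 <= ell) (epsE : eps = expR (- L)) (eps3 : eps <= 1 / 3).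
Hypothesis L_le_n : L <= n%:R.

Lemma ln_ge100_gt0 : (0 : R) < n%:R.
Proof.
rewrite lt0r ler0n andbT; apply: contraTneq ell_ge => ->.
by rewrite ln0 // -ltNge.
Qed.

Lemma ln_ge100_le : (16 * 100) * ell <= n%:R.
Proof.
have ell0 : 0 <= ell by have := ell_ge; lra.
have := expR_ge1Dxn 2 ell0; rewrite lnK ?posrE ?ln_ge100_gt0 //.
rewrite (_ : 3`!%:R = 6 :> R) // => H.
have : (100 * 100) * ell <= ell ^+ 3 by have := ell_ge; set x := ln _ => ?; nra.
by move: H ell0; set y := ell ^+ 3; lra.
Qed.

Lemma ln_ge100_nat : (100 <= n)%N.
Proof. by rewrite -(ler_nat R); have := ln_ge100_le; have := ell_ge; lra. Qed.

Lemma error_log_ge_half : 1 / 2 <= L.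
Proof.
have : 1 + - (1 / 2) <= expR (- (1 / 2) : R) := expR_ge1Dx _.
move=> H; have : expR (- L) <= expR (- (1 / 2)) by rewrite -epsE; have := eps3; lra.
by rewrite ler_expR; lra.
Qed.

(** The error has to beat polynomial factors in n. If [L] is below 400 ln n, about 7200 ln n copies
    reduce the error to exp(-400 ln n), since 8/9 <= exp(-1/9); otherwise one copy suffices. *)
Lemma approx_boost d (f : boolfun n) : approx F d eps f ->
  exists (t : nat) (Lam : R),
  [/\ approx F (t * d) (expR (- Lam)) f, (0 < t)%N, t%:R <= ell ^+ 3,
      (4 * 100) * ell <= Lam & [/\ L <= Lam, Lam <= n%:R & Lam <= (8 * 100) * ell * L]].
Proof.
move=> ap; have e100 := ell_ge; have Lbin := error_log_ge_half; have nl := ln_ge100_le.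
have e2 : (100 * 100) <= ell ^+ 2 by nra.
have e3 : (100 * 100) * ell <= ell ^+ 3 by rewrite [ell ^+ 3]exprS mulrC; apply: ler_wpM2l => //; lra.
have [ge|lt] := leP ((4 * 100) * ell) L.
  exists 1%N, L; split=> //; first by rewrite mul1n -epsE.
    by apply: le_trans e3; lra.
  by split=> //; nra.
pose u := (Num.truncn ((36 * 100) * ell)).+1.
have /andP[u1 u2] : (Num.truncn ((36 * 100) * ell))%:R <= (36 * 100) * ell < u%:R.
  by apply: truncn_itv; lra.
have u3 : u%:R <= (36 * 100) * ell + 1 by rewrite /u -natr1 lerD2r.
exists (2 * u)%N, ((4 * 100) * ell); split=> //.
- apply: approx_le (approx_amplify u eps3 ap).
  apply: (@le_trans _ _ (expR (u%:R * (- (1 / 9))))).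
    have le89 : 8 / 9 <= expR (- (1 / 9)) :> R by apply: le_trans (expR_ge1Dx _); lra.
    by rewrite expRM_natl; apply: lerXn2r le89; rewrite nnegrE ?expR_ge0 //; lra.
  by rewrite ler_expR; lra.
- by rewrite natrM; lra.
- by split; [lra|lra|nra].
Qed.

(** The number of tests costs [ell ^+ 2] and the number of copies [ell ^+ 3]; the last two powers of
    [ell] absorb the constants. *)
Lemma degree_conclude r t d (Lam k : R) : (2 ^ r <= n)%N -> (0 < t)%N -> (0 < d)%N ->
  t%:R <= ell ^+ 3 -> k * Lam <= 8 * (r * (t * d)).+1%:R ^+ 2 ->
  (20 * 100) * (k * Lam) <= (ell ^+ 7 * d%:R) ^+ 2.
Proof.
move=> le_r t0 d0 le_t H; have e100 := ell_ge.
have e0 : 0 <= ell by lra.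
have e2 : (100 * 100) <= ell ^+ 2 by nra.
have r_le : r.+1%:R <= ell ^+ 2.
  have : r%:R * ln 2 <= ell.
    have : ln (2 ^+ r) <= ell by rewrite ler_ln ?posrE ?exprn_gt0 ?ln_ge100_gt0 // -natrX ler_nat.
    by rewrite lnXn // mulr_natl.
  have /andP[l2 _] := ln2_bounds R; have r0 : (0 : R) <= r%:R by [].
  by rewrite -natr1 => H1; nra.
have le1 : (r * (t * d)).+1%:R <= ell ^+ 5 * d%:R.
  apply: (@le_trans _ _ (r.+1%:R * t%:R * d%:R)).
    by rewrite -!natrM ler_nat mulSn mulnDl -mulnA addnC -addn1 leq_add2l muln_gt0 t0.
  rewrite (exprD _ 2 3) ler_wpM2r // ler_pM //.
set X := ell ^+ 5 * d%:R in le1 *.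
have X0 : 0 <= X by rewrite mulr_ge0 ?exprn_ge0.
have -> : ell ^+ 7 * d%:R = ell ^+ 2 * X by rewrite /X mulrA -exprD.
clearbody X.
have : (r * (t * d)).+1%:R ^+ 2 <= X ^+ 2 by rewrite lerXn2r ?nnegrE.
have : (160 * 100) * X ^+ 2 <= (ell ^+ 2) ^+ 2 * X ^+ 2.
  by rewrite ler_wpM2r ?exprn_ge0 //; nra.
by rewrite exprMn; lra.
Qed.

Section Periodic.
Variables (f g h f' : boolfun n).
Hypotheses (dec : std_decomp f g h) (agree : agree_mid f f') (sf' : symfun f').

(** Two consecutive middle weights with different values give a nonconstant function of one bit, and
    error 1/3 is below 1/2. *)
Lemma degree_gt0 d : (1 < per g)%N -> approx F d eps f' -> (0 < d)%N.
Proof.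
move=> b1 ap; have [//|i [_ le ne]] := mid_separation dec agree (d := 1).
rewrite addn1 in ne.
apply: (and_type_degree (m := 1) (s := i) (b := Spec f' i.+1) sf' ap).
- by clear - le; lia.
- by rewrite expr1; have := eps3; lra.
case=> [|[|//]] _; rewrite ?add0n ?add1n; move: ne; by case: (Spec f' i) (Spec f' i.+1) => -[].
Qed.

(** Since [12 * per g <= n], the residue tests fit with [k] about n/10, and congruence modulo
    [per g] implies congruence modulo its prime divisor [q]. *)
Lemma nonpower_period_bound p d : has_char F p -> (1 < per g)%N -> ~ power_of p (per g) ->
  (12 * per g <= n)%N -> approx F d eps f' -> n%:R * L <= (ell ^+ 7 * d%:R) ^+ 2.
Proof.
move=> charp b1 npow le_b ap; have d0 := degree_gt0 b1 ap; have n100 := ln_ge100_nat.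
have [q [q_pr q0 qb]] := nonpower_prime_divisor charp b1 npow.
have [t [Lam [apt t0 le_t ge_Lam [L_Lam Lam_n _]]]] := approx_boost ap.
pose k := (n %/ 10)%N.
have k0R : 0 <= k%:R :> R by [].
have k_ge : n%:R <= 20 * k%:R :> R by rewrite -natrM ler_nat /k; clear - n100; lia.
have [k_gt0 kk_n] : (0 < k)%N /\ (k + k + 2 <= n)%N by rewrite /k; clear - n100; lia.
have [|T [sizeT Tn Tk]] := residue_tests dec agree (k := k).
  by rewrite /k; clear - n100 le_b; lia.
have sizeTn : (2 ^ size T <= n)%N.
  by apply: leq_trans sizeT _; apply: leq_trans le_b; rewrite leq_pmull.
(* [Lam] can be as large as [n]; division by 100 brings it below [2 * k] and leaves at least
   [4 * ell]. *)
have key : k%:R * (Lam / 100) <= 8 * (size T * (t * d)).+1%:R ^+ 2.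
  apply: (@degree_from_binomial _ n) => // [||le_k]; [lra|lra|].
  pose S0 : {set hcube (k + k)} := set0.
  have := binomial_le (S0 := S0) sf' apt Tn le_k.
  rewrite cards0 add0r => H; apply: le_trans (H _) _.
    apply: Or33; exists q; split=> // i le_i /(Tk i le_i) e.
    by rewrite -(modn_dvdm i qb) e modn_dvdm.
  rewrite mulrC ler_wpM2l ?exprn_ge0 // ler_pM ?expR_ge0 //.
    by rewrite ler_nat; apply: leqW; apply: leq_trans sizeTn; rewrite ltnW // ltn_expl.
  by rewrite ler_expR; have := ell_ge; lra.
have := degree_conclude sizeTn t0 d0 le_t key.
apply: le_trans; have := error_log_ge_half; have L0 : 0 <= L by have := error_log_ge_half; lra.
have := ln_ge100_gt0; have := ell_ge => *.
apply: (@le_trans _ _ (20 * k%:R * Lam)); last by lra.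
by apply: ler_pM => //; lra.
Qed.

(** The tests say nothing about layers beyond the window on the relevant side. These form the
    exceptional set, a fraction at most exp(-Lam') of the cube by [tail_bound], as w^2 >= 4 k
    Lam'. *)
Lemma window_degree k w T e (Lam Lam' : R) : approx F e (expR (- Lam)) f' ->
  (forall s, s \in T -> (k + k + s <= n)%N) -> (2 ^ size T <= n)%N ->
  (0 < k)%N -> (k + k + 2 <= n)%N -> (w <= k)%N ->
  4 * k%:R * Lam' <= w%:R ^+ 2 -> Lam' <= Lam -> 4 * ell <= Lam' -> Lam' <= 2 * k%:R ->
  (forall i, (k < i <= k + w)%N -> ~~ passes f' T k i) \/
  (forall i, (k <= i + w)%N -> (i < k)%N -> ~~ passes f' T k i) ->
  k%:R * Lam' <= 8 * (size T * e).+1%:R ^+ 2.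
Proof.
move=> ap Tn sizeTn k_gt0 kk_n w_k w2 le_Lam ge_Lam le_k Tk.
apply: (@degree_from_binomial _ n) => // le_ke.
have k0R : 0 < 4 * k%:R :> R by rewrite mulr_gt0 ?ltr0n.
set P := 2 ^+ (k + k); have P0 : 0 <= P by apply: exprn_ge0.
have tail (A : {set hcube (k + k)}) : (forall y, y \in A -> (k + w <= wt y)%N) \/
    (forall y, y \in A -> (wt y + w <= k)%N) -> #|A|%:R <= P * expR (- Lam').
  move=> HA; apply: le_trans (tail_bound _ k_gt0 w_k HA) _.
  by rewrite ler_wpM2l // ler_expR lerN2 ler_pdivlMr // mulrC.
have errs : (size T)%:R * expR (- Lam) * P <= P * (n%:R * expR (- Lam')).
  rewrite mulrC; apply: ler_wpM2l => //; apply: ler_pM; rewrite ?expR_ge0 //.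
    by rewrite ler_nat; apply: leq_trans sizeTn; rewrite ltnW // ltn_expl.
  by rewrite ler_expR lerN2.
have -> : P * (n.+1%:R * expR (- Lam')) = P * expR (- Lam') + P * (n%:R * expR (- Lam')).
  by rewrite -natr1 mulrDl mul1r mulrDr addrC.
case: Tk => Tk.
  pose A := [set y : hcube (k + k) | (k + w < wt y)%N].
  have tA : #|A|%:R <= P * expR (- Lam').
    by apply: tail; left=> y; rewrite inE => /ltnW.
  apply: le_trans (lerD tA errs); apply: (binomial_le sf' ap Tn le_ke).
  by apply: Or31 => y; rewrite inE -leqNgt => le lt; apply: Tk; rewrite lt.
pose A := [set y : hcube (k + k) | (wt y + w < k)%N].
have tA : #|A|%:R <= P * expR (- Lam').
  by apply: tail; right=> y; rewrite inE => /ltnW.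
apply: le_trans (lerD tA errs); apply: (binomial_le sf' ap Tn le_ke).
by apply: Or32 => y; rewrite inE -leqNgt => le lt; apply: Tk.
Qed.

(** A period below [ell ^+ 3] is covered by [d >= 1]; a longer one leaves room for a window. *)
Lemma long_period_bound d : (1 < per g)%N -> approx F d eps f' ->
  Num.min (n%:R * L) ((per g)%:R ^+ 2) <= (ell ^+ 7 * d%:R) ^+ 2.
Proof.
move=> b1 ap; have d0 := degree_gt0 b1 ap; have n100 := ln_ge100_nat.
have e100 := ell_ge; have Lbin := error_log_ge_half; have nl := ln_ge100_le.
have d1 : 1 <= d%:R :> R by rewrite ler1n.
have e2 : (100 * 100) <= ell ^+ 2 by nra.
set b := per g in b1 *; have b_n : (b <= n %/ 3 + 1)%N := per_le_third dec.
have [small|big] := leP (b%:R : R) (ell ^+ 3).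
  rewrite ge_min; apply/orP; right; apply: lerXn2r; rewrite ?nnegrE ?mulr_ge0 ?exprn_ge0 //; try lra.
  apply: le_trans small _; rewrite -[leLHS]mulr1; apply: ler_pM => //; first by rewrite exprn_ge0 //; lra.
  by apply: ler_weXn2l => //; lra.
have [t [Lam [apt t0 le_t ge_Lam [L_Lam Lam_n _]]]] := approx_boost ap.
have b_big : 100 * 100 * ell <= b%:R.
  by apply: le_trans (ltW big); rewrite [ell ^+ 3]exprS mulrC; apply: ler_wpM2l => //; lra.
(* The cap at [b] is what [window_parameters] asks for. When it is active and [k] has order [n], the
   bound n b still dominates b^2. *)
pose M := Num.min Lam b%:R.
have M_Lam : M <= Lam by rewrite ge_min lexx.
have M_b : M <= b%:R by rewrite ge_min lexx orbT.
have M_ge : 4 * 100 * ell <= M by rewrite le_min ge_Lam; lra.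
have [|k [w [k_gt0 w_k w_b k_n [k_M kM_w k_or]]]] := window_parameters _ M_b b_n; first by lra.
have M0 : 0 <= M by lra.
have [kk_n w_n] : (k + k + 2 <= n)%N /\ (2 * w + 1 <= n)%N by clear - k_n w_k n100; lia.
have [||T [sizeT Tn Tk]] := window_tests dec agree (k := k) (w := w).
- by clear - b1 w_b; rewrite -/b; lia.
- by clear - k_n w_k; lia.
have sizeTn : (2 ^ size T <= n)%N by apply: leq_trans sizeT w_n.
have key : k%:R * (M / 100) <= 8 * (size T * (t * d)).+1%:R ^+ 2.
  by apply: (window_degree apt Tn sizeTn k_gt0 kk_n w_k _ _ _ _ Tk); lra.
apply: le_trans (degree_conclude sizeTn t0 d0 le_t key).
have {key}-> : (20 * 100) * (k%:R * (M / 100)) = 20 * (k%:R * M) :> R by field.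
have k0R : 0 <= k%:R * M by rewrite mulr_ge0.
rewrite ge_min; case: k_or => [kn|kb]; last by apply/orP; right; apply: le_trans kb _; lra.
have nM : n%:R * M <= 20 * (k%:R * M) by rewrite mulrA ler_wpM2r.
apply/orP; move: nM; rewrite /M; case: (leP Lam b%:R) => _ nM; [left|right].
  by apply: le_trans nM; rewrite ler_wpM2l.
by apply: le_trans nM; rewrite expr2 ler_wpM2r // ler_nat; clear - b_n n100; lia.
Qed.

End Periodic.
End Bounds.

(** * Degree bounds coming from [Bnd h] *)

Section BoundedDegree.
Variables (R : realType) (F : fieldType) (n : nat) (eps L : R).
Notation ell := (ln n%:R : R).
Hypotheses (ell_ge : 100 <= ell) (epsE : eps = expR (- L)) (eps3 : eps <= 1 / 3).
Hypothesis L_le_n : L <= n%:R.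
Variables (f g h : boolfun n).
Hypotheses (sf : symfun f) (dec : std_decomp f g h) (B_gt0 : (0 < Bnd h)%N).

(** The layer [(Bnd h).-1], or its mirror image, is nonzero and borders a long run of zero layers,
    so [h] restricts to an and-type function on a subcube. *)
Lemma bounded_degree_log d : approx F d eps h -> L <= 4 * d%:R.
Proof.
move=> ap; have n100 := ln_ge100_nat ell_ge; have B3 := Bnd_le dec.
(* Dimension [m1] keeps the expected number of errors below 1, because 2 < e; [m2] is the length of
   the run of zero layers. *)
pose m1 := maxn 1 (Num.truncn L); pose m2 := (n.+1 - 2 * Bnd h)%N.
have Lbin : 1 / 2 <= L by apply: error_log_ge_half epsE eps3.
have /andP[tr1 tr2] : (Num.truncn L)%:R <= L < (Num.truncn L).+1%:R by apply: truncn_itv; lra.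
have lt1 : eps * 2 ^+ m1 < 1.
  rewrite /m1; case: (leqP (Num.truncn L) 1) => [_|gt1]; first by rewrite expr1; have := eps3; lra.
  rewrite epsE expRN mulrC ltr_pdivrMr ?expR_gt0 // mul1r.
  apply: (@lt_le_trans _ _ (expR ((Num.truncn L)%:R * 1))); last by rewrite mulr1 ler_expR.
  rewrite expRM_natl ltrXn2r ?nnegrE ?expR_ge0 //.
    by case: (Num.truncn L) gt1.
  by have : 1 + 1 < expR (1 : R) := expR_gt1Dx (oner_neq0 _); lra.
have lt_m m : (m <= m1)%N -> eps * 2 ^+ m < 1.
  move=> le; apply: le_lt_trans lt1; rewrite ler_wpM2l ?epsE ?expR_ge0 //.
  by apply: ler_weXn2l => //; lra.
pose m := minn m1 m2.
have m_m1 : (m <= m1)%N by rewrite /m geq_minl.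
have m_m2 : (m <= m2)%N by rewrite /m geq_minr.
have le_d : (m <= d)%N.
  have sh := symfun_h sf dec; have n6 : (6 <= n)%N by clear - n100; lia.
  have zero i := @Bnd_zero _ _ _ _ dec i n6.
  have [hB|hB] := Bnd_nonzero dec n6 B_gt0.
    apply: (and_type_degree (s := (Bnd h).-1) (b := false) sh ap _ (lt_m m m_m1)).
      by move: m_m2; rewrite /m2; clear - B3 n100 B_gt0; lia.
    case=> [|i] le_i; first by rewrite add0n hB.
    by rewrite zero //; move: le_i m_m2; rewrite /m2; clear - B3 n100 B_gt0; lia.
  apply: (and_type_degree (s := n - (Bnd h).-1 - m) (b := true) sh ap _ (lt_m m m_m1)).
    by move: m_m2; rewrite /m2; clear - B3 n100 B_gt0; lia.
  move=> i; rewrite leq_eqVlt => /orP[/eqP->|lt_i].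
    rewrite eqxx subnKC ?hB //.
    by move: m_m2; rewrite /m2; clear - B3 n100 B_gt0; lia.
  rewrite ltn_eqF // zero //; move: lt_i m_m2; rewrite /m2; clear - B3 n100 B_gt0; lia.
apply: (@le_trans _ _ (4 * m%:R)); last by rewrite ler_wpM2l // ler_nat.
have : n%:R <= 4 * m2%:R :> R.
  by rewrite -natrM ler_nat /m2; clear - B3 n100 B_gt0; lia.
have : L <= 4 * m1%:R.
  have : (Num.truncn L)%:R <= m1%:R :> R by rewrite ler_nat leq_maxr.
  have : 1 <= m1%:R :> R by rewrite ler1n leq_maxl.
  by move: tr2; rewrite -natr1; lra.
by rewrite /m; case: (leqP m1 m2) => _ //; have := L_le_n; lra.
Qed.

(** With [k = (Bnd h).-1], a single test separates layer [k] of the cube of dimension [2 * k] from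
    all layers on one side, so there is no exceptional set. *)
Lemma bounded_degree_sqrt d : approx F d eps h -> (Bnd h)%:R * L <= (ell ^+ 7 * d%:R) ^+ 2.
Proof.
move=> ap; have n100 := ln_ge100_nat ell_ge; have B3 := Bnd_le dec.
have Lbin : 1 / 2 <= L by apply: error_log_ge_half epsE eps3.
have L4d := bounded_degree_log ap; have e100 := ell_ge.
have d0 : (0 < d)%N by rewrite -(ltr_nat R); lra.
have [t [Lam [apt t0 le_t ge_Lam [L_Lam Lam_n Lam_L]]]] := approx_boost ell_ge epsE eps3 L_le_n ap.
pose k := (Bnd h).-1.
have BE : (Bnd h)%:R = k%:R + 1 :> R by rewrite natr1 prednK.
(* If [2 * k < Lam], then [Bnd h] is at most a multiple of [ell * L], and the logarithmic bound
   suffices. *)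
have [le_k|gt_k] := leP Lam (2 * k%:R); last first.
  have d0R : 0 <= d%:R :> R by [].
  have LL : L ^+ 2 <= 16 * d%:R ^+ 2.
    have -> : 16 * d%:R ^+ 2 = (4 * d%:R) ^+ 2 :> R by ring.
    by apply: lerXn2r; rewrite ?nnegrE //; lra.
  have : (Bnd h)%:R * L <= (5 * 100 * ell) * L ^+ 2.
    rewrite expr2 mulrA ler_wpM2r //; first by lra.
    by rewrite BE; nra.
  move=> /le_trans; apply.
  apply: (@le_trans _ _ (5 * 100 * ell * (16 * d%:R ^+ 2))).
    by apply: ler_wpM2l LL; lra.
  rewrite exprMn -exprM mulrA; apply: ler_wpM2r; first exact: exprn_ge0.
  apply: (@le_trans _ _ (ell ^+ 3)); last by apply: ler_weXn2l => //; lra.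
  have e2 : 100 * 100 <= ell ^+ 2 by nra.
  have : ell * (100 * 100) <= ell * ell ^+ 2 by apply: ler_wpM2l e2; lra.
  by rewrite -exprS; lra.
have k_gt0 : (0 < k)%N by rewrite -(ltr_nat R); lra.
have kk_n : (k + k + 2 <= n)%N by rewrite /k; clear - B3 n100 B_gt0; lia.
have n6 : (6 <= n)%N by clear - n100; lia.
have [T [size1 Tn side]] : exists T, [/\ size T = 1%N, forall s, s \in T -> (k + k + s <= n)%N &
    (forall i, (k < i <= k + k)%N -> ~~ passes h T k i) \/
    (forall i, (i < k)%N -> ~~ passes h T k i)].
  have zero i := @Bnd_zero _ _ _ _ dec i n6.
  have [hB|hB] := Bnd_nonzero dec n6 B_gt0.
    exists [:: 0%N]; split=> //.
      by move=> s; rewrite inE => /eqP->; clear - kk_n; lia.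
    left=> i /andP[lt le]; rewrite /passes /= andbT !addn0 hB zero //;
      move: lt le; rewrite /k; clear - B3 n100 B_gt0; lia.
  (* This shift sends layer [k] to the weight [n - (Bnd h).-1] and lower layers into the zero
     range. *)
  exists [:: (n - (k + k))%N]; split=> //.
    by move=> s; rewrite inE => /eqP->; clear - kk_n; lia.
  right=> i lt; rewrite /passes /= andbT.
  have -> : (k + (n - (k + k)) = n - (Bnd h).-1)%N by move: kk_n; rewrite -/k; clear; clearbody k; lia.
  by rewrite hB zero //; move: lt; rewrite /k; clear - B3 n100 B_gt0; lia.
have key : k%:R * Lam <= 8 * (1 * (t * d)).+1%:R ^+ 2.
  apply: (@degree_from_binomial _ n) => // [|le_ke]; first by lra.
  pose S0 : {set hcube (k + k)} := set0.
  rewrite -size1 in le_ke *.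
  have := binomial_le (S0 := S0) (symfun_h sf dec) apt Tn le_ke.
  rewrite cards0 add0r => H; apply: le_trans (H _) _.
    case: side => side; [apply: Or31|apply: Or32] => y _ => [lt|]; last exact: side.
    by apply: side; rewrite lt wt_le.
  rewrite size1 mul1r mulrC ler_wpM2l ?exprn_ge0 // ler_peMl ?expR_ge0 // ler1n //.
have n2 : (2 ^ 1 <= n)%N by clear - n6; lia.
apply: le_trans (degree_conclude ell_ge n2 t0 d0 le_t key).
have k1 : 1 <= k%:R :> R by rewrite ler1n.
apply: (@le_trans _ _ (2 * k%:R * Lam)); first by apply: ler_pM; lra.
have : 0 <= k%:R * Lam by apply: mulr_ge0; lra.
lra.
Qed.

End BoundedDegree.

(** * Passing to binary logarithms and combining the bounds *)

Section Assembly.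
Variables (R : realType) (F : fieldType) (p n : nat) (eps L : R).
Notation ell := (ln n%:R : R).
Notation Lbin := (L / ln 2).
Hypotheses (ell_ge : 100 <= ell) (epsE : eps = expR (- L)) (eps3 : eps <= 1 / 3).
Hypothesis L_le_n : L <= n%:R.
Hypothesis charp : has_char F p.
Variables (f g h : boolfun n).
Hypotheses (sf : symfun f) (dec : std_decomp f g h).

Lemma ell_pow_le i j d : (i <= j)%N -> ell ^+ i * d%:R <= ell ^+ j * d%:R.
Proof.
by move=> le_ij; rewrite ler_wpM2r // ler_weXn2l //; have := ell_ge; lra.
Qed.

Lemma ell_pow_mul c i x : 0 <= x -> c <= 100 -> c * (ell ^+ i * x) <= ell ^+ i.+1 * x.
Proof.
move=> x0 c100; have e100 := ell_ge.
rewrite exprS -mulrA; apply: ler_wpM2r; last by lra.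
by rewrite mulr_ge0 // exprn_ge0 //; lra.
Qed.

Lemma log2_le : Lbin <= 2 * L.
Proof.
have Lh := error_log_ge_half epsE eps3; have /andP[l2 _] := ln2_bounds R.
by rewrite ler_pdivrMr; nra.
Qed.

Lemma sqrt_log2_le (x d i : nat) : x%:R * L <= (ell ^+ i * d%:R) ^+ 2 ->
  Num.sqrt (x%:R * Lbin) <= ell ^+ i.+1 * d%:R.
Proof.
move=> H; have e100 := ell_ge.
have Y0 j : 0 <= ell ^+ j * d%:R by rewrite mulr_ge0 // exprn_ge0 //; lra.
rewrite -[leRHS]ger0_norm // -sqrtr_sqr ler_sqrt ?exprn_ge0 //.
apply: (@le_trans _ _ (x%:R * (2 * L))); first by rewrite ler_wpM2l // log2_le.
have : (2 * (ell ^+ i * d%:R)) ^+ 2 <= (ell ^+ i.+1 * d%:R) ^+ 2.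
  apply: lerXn2r; rewrite ?nnegrE ?Y0 //; first by rewrite mulr_ge0.
  by apply: ell_pow_mul => //; lra.
apply: le_trans; rewrite exprMn.
have := sqr_ge0 (ell ^+ i * d%:R); lra.
Qed.

Lemma period_lower_bound f' d : agree_mid f f' -> symfun f' -> (1 < per g)%N -> approx F d eps f' ->
  Num.sqrt (n%:R * Lbin) <= ell ^+ 8 * d%:R \/ (per g)%:R <= ell ^+ 7 * d%:R.
Proof.
move=> agree sf' b1 ap.
have := long_period_bound ell_ge epsE eps3 L_le_n dec agree sf' b1 ap.
rewrite ge_min => /orP[H|H]; [left; exact: sqrt_log2_le|right].
have Y0 : 0 <= ell ^+ 7 * d%:R.
  by rewrite mulr_ge0 // exprn_ge0 //; have := ell_ge; lra.
by rewrite -(ler_pXn2r (n := 2)) ?nnegrE.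
Qed.

Lemma nonpower_lower_bound f' d : agree_mid f f' -> symfun f' -> (1 < per g)%N ->
  ~ power_of p (per g) -> approx F d eps f' ->
  Num.sqrt (n%:R * Lbin) <= ell ^+ 9 * d%:R.
Proof.
move=> agree sf' b1 npow ap; have e100 := ell_ge.
apply: sqrt_log2_le.
have Y0 j : 0 <= ell ^+ j * d%:R by rewrite mulr_ge0 // exprn_ge0 //; lra.
have small : (100 * (ell ^+ 7 * d%:R)) ^+ 2 <= (ell ^+ 8 * d%:R) ^+ 2.
  apply: lerXn2r; rewrite ?nnegrE ?Y0 //; first by rewrite mulr_ge0.
  by apply: ell_pow_mul => //; lra.
apply: le_trans small; rewrite exprMn; set X := (_ ^+ 7 * _) ^+ 2.
have X0 : 0 <= X by apply: sqr_ge0.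
(* A period above n/12 has no room for residue tests, but then n L <= n^2 <= (12 per(g))^2 and
   [long_period_bound] is enough. *)
have [le_b|gt_b] := leqP (12 * per g) n.
  have := nonpower_period_bound ell_ge epsE eps3 L_le_n dec agree sf' charp b1 npow le_b ap.
  by rewrite -/X; lra.
have := long_period_bound ell_ge epsE eps3 L_le_n dec agree sf' b1 ap.
rewrite -/X ge_min => /orP[|H]; first by lra.
have nb : n%:R <= 12 * (per g)%:R :> R by rewrite -natrM ler_nat ltnW.
apply: (@le_trans _ _ ((12 * (per g)%:R) ^+ 2)); last by rewrite exprMn; lra.
apply: (@le_trans _ _ (n%:R * n%:R)); first by rewrite ler_wpM2l // L_le_n.
by rewrite -expr2; apply: lerXn2r; rewrite ?nnegrE ?mulr_ge0.
Qed.

Lemma bounded_lower_bound d : (0 < Bnd h)%N -> approx F d eps h ->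
  Num.sqrt ((Bnd h)%:R * Lbin) + Lbin <= ell ^+ 9 * d%:R.
Proof.
move=> B0 ap; have e100 := ell_ge.
have H1 := sqrt_log2_le (bounded_degree_sqrt ell_ge epsE eps3 L_le_n sf dec B0 ap).
have H2 := bounded_degree_log ell_ge epsE eps3 L_le_n sf dec B0 ap.
have H3 := log2_le.
have d0 : 0 <= d%:R :> R by [].
have H4 := @ell_pow_le 0 8 d isT; rewrite expr0 mul1r in H4.
have : 9 * (ell ^+ 8 * d%:R) <= ell ^+ 9 * d%:R by apply: ell_pow_mul => //; lra.
by lra.
Qed.

(* In characteristic p the function g has degree below per(g), so a polynomial
   for f gives one for h whose degree is larger by less than per(g). *)
Lemma combined_lower_bound d : power_of p (per g) -> (0 < Bnd h)%N -> approx F d eps f ->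
  Num.min (Num.sqrt (n%:R * Lbin)) ((per g)%:R + Num.sqrt ((Bnd h)%:R * Lbin) + Lbin)
    <= ell ^+ 18 * d%:R.
Proof.
move=> [k perE] B0 ap; have e100 := ell_ge.
have dg : lowdeg (per g).-1 (fun a => (g a)%:R : F).
  rewrite perE; apply: lowdeg_period => //; first by have [] := dec.
  by rewrite -perE per_period.
have aph : approx F (d + (per g).-1) eps h.
  by apply: approx_addb ap dg _ => a; have [_ _ _ ->] := dec; rewrite ffunE.
have H := bounded_lower_bound B0 aph.
have d0 : 0 <= d%:R :> R by [].
have b0 := per_gt0 g.
rewrite ge_min; apply/orP.
(* With period 1 the degree does not grow, and the summand [per g] is paid by [d >= 1]. *)
have [b1|b1] := eqVneq (per g) 1%N.
  right; rewrite b1 /= addn0 in aph H *.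
  have L4 := bounded_degree_log ell_ge epsE eps3 L_le_n sf dec B0 aph.
  have Lh := error_log_ge_half epsE eps3.
  have d1 : 1 <= d%:R :> R by rewrite ler1n -(ltr_nat R); lra.
  have := @ell_pow_le 0 9 d isT; rewrite expr0 mul1r => H0.
  have : 2 * (ell ^+ 9 * d%:R) <= ell ^+ 10 * d%:R by apply: ell_pow_mul => //; lra.
  by have := @ell_pow_le 10 18 d isT; lra.
(* Either the minimum is met by its first term, or [per g] is at most [ell ^+ 7 * d], so that the
   increase of the degree costs only powers of [ell]. *)
have [|H1|H1] := period_lower_bound (fun=> fun=> erefl) sf _ ap; first by rewrite ltn_neqAle eq_sym b1.
  by left; apply: le_trans H1 (ell_pow_le _ _).
right.
have D1 : (d + (per g).-1)%:R <= ell ^+ 8 * d%:R.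
  apply: (@le_trans _ _ (d%:R + (per g)%:R)).
    by rewrite -natrD ler_nat leq_add2l leq_pred.
  have := @ell_pow_le 0 7 d isT; rewrite expr0 mul1r => H0.
  have : 2 * (ell ^+ 7 * d%:R) <= ell ^+ 8 * d%:R by apply: ell_pow_mul => //; lra.
  by lra.
have : ell ^+ 9 * (d + (per g).-1)%:R <= ell ^+ 17 * d%:R.
  rewrite (exprD _ 9 8) -mulrA ler_wpM2l // exprn_ge0 //; lra.
have : 2 * (ell ^+ 17 * d%:R) <= ell ^+ 18 * d%:R by apply: ell_pow_mul => //; lra.
by have := @ell_pow_le 7 17 d isT; lra.
Qed.

(** The natural logarithm is at most the binary one, so the constant 1 is enough. *)
Lemma tOmega_of_le (x : nat) (y : R) : y <= ell ^+ 18 * x%:R -> tOmega 1 18 n x%:R y.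
Proof.
move=> H; have e100 := ell_ge; have /andP[l2 l2'] := ln2_bounds R.
have le : ell <= log2 n%:R by rewrite /log2 ler_pdivlMr; nra.
rewrite /tOmega mul1r ler_pdivrMr; last by apply: exprn_gt0; lra.
apply: le_trans H _; rewrite mulrC ler_wpM2l //.
by apply: lerXn2r le; rewrite nnegrE /log2 ?divr_ge0 //; lra.
Qed.

End Assembly.

Lemma ln_unbounded (R : realType) (x : R) :
  exists n0 : nat, forall n, (n0 <= n)%N -> x <= ln n%:R.
Proof.
exists (Num.truncn (expR x)).+1 => n le_n.
have /andP[_ lt] := truncn_itv (ltW (expR_gt0 x)).
have le : expR x <= n%:R by apply: le_trans (ltW lt) _; rewrite ler_nat.
by rewrite -ler_expR lnK // posrE; apply: lt_le_trans (expR_gt0 x) le.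
Qed.

Theorem theorem1p4 (R : realType) (p : nat) :
  exists (c : R) (k n0 : nat), 0 < c /\
  forall (F : fieldType) (n : nat) (f g h : boolfun n) (eps : R),
    has_char F p -> (n0 <= n)%N ->
    symfun f -> std_decomp f g h ->
    1 / 2 ^+ n <= eps <= 1 / 3 ->
    let L := log2 (1 / eps) in
    let Om (x : nat) (y : R) := tOmega c k n x%:R y in
    [/\
      ((1 < per g)%N /\ ~ power_of p (per g) ->
         Om (pdeg F eps g) (Num.sqrt (n%:R * L))) /\
      (~ ((1 < per g)%N /\ ~ power_of p (per g)) ->
         (1 < per g)%N ->
         Om (pdeg F eps g) (Num.min (Num.sqrt (n%:R * L)) (per g)%:R)),
      (1 <= Bnd h)%N ->
         Om (pdeg F eps h) (Num.sqrt ((Bnd h)%:R * L) + L) &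
      [/\ (1 < per g)%N /\ ~ power_of p (per g) ->
            Om (pdeg F eps f) (Num.sqrt (n%:R * L)),
          power_of p (per g) /\ Bnd h = 0%N -> (1 < per g)%N ->
            Om (pdeg F eps f) (Num.min (Num.sqrt (n%:R * L)) (per g)%:R) &
          ~ ((1 < per g)%N /\ ~ power_of p (per g)) ->
          ~ (power_of p (per g) /\ Bnd h = 0%N) ->
            Om (pdeg F eps f)
              (Num.min (Num.sqrt (n%:R * L))
                 ((per g)%:R + Num.sqrt ((Bnd h)%:R * L) + L))]].
Proof.
have [n0 Hn0] := ln_unbounded (100 : R).
exists 1, 18%N, n0; split; first exact: ltr01.
move=> F n f g h eps charp /Hn0 ell_ge sf dec /andP[eps_ge eps3] L Om.
have eps0 : 0 < eps by apply: lt_le_trans eps_ge; rewrite divr_gt0 ?exprn_gt0.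
pose L0 := - ln eps.
have epsE : eps = expR (- L0) by rewrite /L0 opprK lnK.
have LE : L = L0 / ln 2 by rewrite /L /log2 div1r lnV // posrE.
have L0n : L0 <= n%:R.
  have /andP[_ l2] := ln2_bounds R.
  apply: (@le_trans _ _ (n%:R * ln 2)); last by rewrite ler_piMr.
  rewrite -ler_expR expRM_natl lnK ?posrE // -[leLHS]invrK -expRN -epsE.
  rewrite -[leRHS]invrK lef_pV2 ?posrE ?invr_gt0 ?exprn_gt0 //.
  by rewrite -div1r.
have ap (f' : boolfun n) : approx F (pdeg F eps f') eps f'.
  by apply: pdeg_le_approx; case: (pdegP F f' (ltW eps0)).
have [sg ag _ _] := dec.
have nonpow f' : agree_mid f f' -> symfun f' -> (1 < per g)%N /\ ~ power_of p (per g) ->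
    Om (pdeg F eps f') (Num.sqrt (n%:R * L)).
  move=> agree sf' [b1 npow]; rewrite /Om LE; apply: tOmega_of_le => //.
  apply: le_trans (ell_pow_le ell_ge _ (isT : 9 <= 18)%N).
  exact: (nonpower_lower_bound ell_ge epsE eps3 L0n charp dec agree sf' b1 npow (ap f')).
have pow f' : agree_mid f f' -> symfun f' -> (1 < per g)%N ->
    Om (pdeg F eps f') (Num.min (Num.sqrt (n%:R * L)) (per g)%:R).
  move=> agree sf' b1; rewrite /Om LE; apply: tOmega_of_le => //; rewrite ge_min.
  have [H|H] := period_lower_bound ell_ge epsE eps3 L0n dec agree sf' b1 (ap f').
    by rewrite (le_trans H) // ell_pow_le.
  by apply/orP; right; rewrite (le_trans H) // ell_pow_le.
split; [split=> [H|_ b1]|move=> B1|split=> [H|_ b1|np nB]].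
- exact: nonpow.
- exact: pow.
- rewrite /Om LE; apply: tOmega_of_le => //.
  apply: le_trans (ell_pow_le ell_ge _ (isT : 9 <= 18)%N).
  exact: (bounded_lower_bound ell_ge epsE eps3 L0n sf dec B1 (ap h)).
- exact: nonpow.
- exact: pow.
(* The remaining case includes period 1, which is p^0 for every [p]. *)
have powb : power_of p (per g).
  apply: contrapT => npow; apply: np; split=> //.
  have := per_gt0 g; rewrite leq_eqVlt => /orP[/eqP b1|//].
  by case: npow; exists 0%N; rewrite -b1.
have B0 : (0 < Bnd h)%N by rewrite lt0n; apply/eqP => B0; apply: nB.
rewrite /Om LE; apply: tOmega_of_le => //.
exact: (combined_lower_bound ell_ge epsE eps3 L0n charp sf dec powb B0 (ap f)).
Qed.
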